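(* Let $R>0$ and let $L=\{x\in\mathbb{R}^n: g_i(x)\ge0,\ i=1,\dots,N_c\}$ be a basic semialgebraic set with polynomials $g_i\in\mathbb{R}[x]$, whose description includes the ball constraint $R^2-\|x\|_2^2\ge0$ (so that $L\subseteq B_R^n$). For $k\in\mathbb{N}$ let $p_k^*$ be the infimum of $\gamma$ over all $\gamma\in\mathbb{R}$ and polynomials $w\in\mathbb{R}[\theta,t,Z,y]_{\le 2k}$ satisfying $$\gamma-\Lambda_R w(\theta,t,Z)\in\Sigma[\Omega_Z]_{\le 2k},\qquad w-1\in\Sigma[\Psi_L]_{\le 2k},\qquad w\in\Sigma[\Psi]_{\le 2k}.$$ Then $p_k^*\ge p_{k+1}^*\ge\cdots$ is a decreasing sequence of upper bounds on $$P^*=\sup_{\theta\in S^{n-1},\ t\in[-R,R]}\mathrm{Vol}_{n-1}\bigl(\{x\in L:\theta\cdot x=t\}\bigr),$$ and $\lim_{k\to\infty}p_k^*=P^*$.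
   Context: $n$ is a positive integer, $B_R^m=\{y\in\mathbb{R}^m:\|y\|_2\le R\}$, $S^{n-1}$ is the unit sphere of $\mathbb{R}^n$, $O(n)$ is the orthogonal group, $\mathrm{Vol}_{n-1}$ is $(n-1)$-dimensional volume in the hyperplane, and $\mathbb{R}[x]_{\le d}$ is the set of real polynomials of degree at most $d$. Define $\Omega_Z=\{(\theta,t,Z)\in S^{n-1}\times[-R,R]\times\mathbb{R}^{n\times(n-1)}:[\theta,Z]\in O(n)\}$, $\Psi=\Omega_Z\times B_R^{n-1}$ (points $(\theta,t,Z,y)$), $\Psi_L=\{(\theta,t,Z,y)\in\Psi:\theta t+Zy\in L\}$, $\Lambda_R w(\theta,t,Z)=\int_{B_R^{n-1}}w(\theta,t,Z,y)\,dy$. For a basic semialgebraic set $\mathbb{K}=\{x: h_j(x)\ge0,\ j=1,\dots,m\}$ with fixed describing polynomials $h_j$, $\Sigma[\mathbb{K}]_{\le2k}$ is the set of polynomials $\sigma_0+\sum_j\sigma_jh_j$ where $\sigma_0,\sigma_j$ are sums of squares of polynomials, $\deg\sigma_0\le2k$ and $\deg(\sigma_jh_j)\le2k$ for all $j$. An equality constraint $h=0$ counts as the two inequalities $h\ge0$, $-h\ge0$. The describing constraints are: for $\Omega_Z$, $R^2-t^2\ge0$ together with the polynomial equations (entries of) $[\theta,Z]^T[\theta,Z]=I$ (which contain $\|\theta\|_2^2=1$); for $\Psi$, these and $R^2-\|y\|_2^2\ge0$; for $\Psi_L$, those of $\Psi$ and $g_i(\theta t+Zy)\ge0$, $i=1,\dots,N_c$.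 The infimum over an empty set is $+\infty$. *)

(* Defs.v *)
From HB Require Import structures.
From mathcomp Require Import all_boot all_order all_algebra.
(* The notations of mpoly.v clash with those of MathComp-Analysis, which also
   has to be imported last because both libraries declare isMeasure. *)
From mathcomp Require Import -(notations) mpoly.
From mathcomp Require Import all_classical all_reals all_analysis.

Set Implicit Arguments.
Unset Strict Implicit.
Unset Printing Implicit Defensive.

Import Order.TTheory GRing.Theory Num.Theory.
Import numFieldNormedType.Exports.

Local Open Scope classical_set_scope.
Local Open Scope ring_scope.

Notation "{ 'mpoly' T [ n ] }" := (mpoly.mpoly n T)
  (at level 0, T, n at level 2).

Section lebesgue_tuple.
Context {R : realType}.
Local Open Scope ereal_scope.

Definition cons_tuple m (p : measurableTypeR R * m.-tuple R) : m.+1.-tuple R :=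
  [tuple of (p.1 : R) :: p.2].

(* Lebesgue measure on R^m as an iterated product measure; R^0 is a point of
   mass 1. *)
Fixpoint lebesgue_tuple m : set (m.-tuple R) -> \bar R :=
  match m with
  | 0 => \d_[tuple]
  | m'.+1 => pushforward (@lebesgue_measure R \x @lebesgue_tuple m')
               (@cons_tuple m')
  end.

Lemma measurable_cons_tuple m : measurable_fun [set: _] (@cons_tuple m).
Proof.
apply: (@measurable_cons _ _ _ _ (fun p : measurableTypeR R * m.-tuple R =>
  p.1 : R) m snd); last exact: measurable_snd.
exact: (@measurable_fst _ _ (measurableTypeR R) (m.-tuple R)).
Qed.

Definition uncons_tuple m (x : m.+1.-tuple R) :
  measurableTypeR R * m.-tuple R := (thead x : R, [tuple of behead x]).

Lemma measurable_uncons_tuple m : measurable_fun [set: _] (@uncons_tuple m).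
Proof.
apply/measurable_fun_pairP; split.
  exact: (@measurable_tnth _ R m.+1 ord0).
exact: measurable_behead.
Qed.

Section lebesgue_tuple_step.
Variables (m : nat) (mu : {sigma_finite_measure set (m.-tuple R) -> \bar R}).

Let nu : set (m.+1.-tuple R) -> \bar R :=
  pushforward (@lebesgue_measure R \x mu) (@cons_tuple m).

Let nuE : nu = measure_function_pushforward__canonical__measure_function_Measure
  (@lebesgue_measure R \x mu) (@measurable_cons_tuple m) :> (set _ -> _).
Proof. by []. Qed.

Let nu0 : nu set0 = 0. Proof. by rewrite nuE measure0. Qed.

Let nu_ge0 A : 0 <= nu A. Proof. by rewrite nuE measure_ge0. Qed.

Let nu_sigma_additive : semi_sigma_additive nu.
Proof. by rewrite nuE; exact: measure_semi_sigma_additive. Qed.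

HB.instance Definition _ := isMeasure.Build _ _ _ nu
  nu0 nu_ge0 nu_sigma_additive.

Let nu_sigma_finite : sigma_finite [set: _] nu.
Proof.
have /sigma_finiteP[F [TF ndF Foo]] := sigma_finiteT (@lebesgue_measure R).
have /sigma_finiteP[G [TG ndG Goo]] := sigma_finiteT mu.
exists (fun k => @uncons_tuple m @^-1` (F k `*` G k)).
  apply/seteqP; split => // x _.
  have [i _ Fi] : (\bigcup_i F i) (thead x) by rewrite -TF.
  have [j _ Gj] : (\bigcup_i G i) [tuple of behead x] by rewrite -TG.
  exists (maxn i j) => //; split => /=.
    by move: Fi; exact/subsetPset/ndF/leq_maxl.
  by move: Gj; exact/subsetPset/ndG/leq_maxr.
move=> k; have [mFk Fkoo] := Foo k; have [mGk Gkoo] := Goo k; split.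
  rewrite -[X in measurable X]setTI.
  by apply: measurable_uncons_tuple => //; exact: measurableX.
rewrite /nu /pushforward -comp_preimage.
rewrite (_ : _ \o _ = id) ?preimage_id; last first.
  apply/funext => -[x y]; rewrite /uncons_tuple /cons_tuple /=.
  by congr pair; exact: val_inj.
by rewrite product_measure1E// lte_mul_pinfty// ge0_fin_numE.
Qed.

HB.instance Definition _ := Measure_isSigmaFinite.Build _ _ _ nu
  nu_sigma_finite.

Lemma lebesgue_tuple_step :
  exists mu' : {sigma_finite_measure set (m.+1.-tuple R) -> \bar R},
    nu = mu' :> (set (m.+1.-tuple R) -> \bar R).
Proof. by exists nu. Qed.

End lebesgue_tuple_step.

Let lebesgue_tuple_exists m :
  exists mu : {sigma_finite_measure set (m.-tuple R) -> \bar R},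
    @lebesgue_tuple m = mu :> (set (m.-tuple R) -> \bar R).
Proof.
elim: m => [|m [mu /= ->]]; first by exists (\d_[tuple]).
exact: lebesgue_tuple_step.
Qed.

Section lebesgue_tuple_instances.
Variable m : nat.
Local Notation mu := (@lebesgue_tuple m).

Let mu0 : mu set0 = 0.
Proof. by have [nu ->] := lebesgue_tuple_exists m; rewrite measure0. Qed.

Let mu_ge0 A : 0 <= mu A.
Proof. by have [nu ->] := lebesgue_tuple_exists m; rewrite measure_ge0. Qed.

Let mu_sigma_additive : semi_sigma_additive mu.
Proof.
by have [nu ->] := lebesgue_tuple_exists m; exact: measure_semi_sigma_additive.
Qed.

HB.instance Definition _ := isMeasure.Build _ _ _ mu
  mu0 mu_ge0 mu_sigma_additive.

Let mu_sigma_finite : sigma_finite [set: _] mu.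
Proof.
by have [nu ->] := lebesgue_tuple_exists m; exact: sigma_finiteT.
Qed.

HB.instance Definition _ := Measure_isSigmaFinite.Build _ _ _ mu
  mu_sigma_finite.

End lebesgue_tuple_instances.

End lebesgue_tuple.

Section geometry.
Context {R : realType}.

Definition norm2 k (x : 'cV[R]_k) : R := Num.sqrt (\sum_i x i 0 ^+ 2).

Definition dotp k (x y : 'cV[R]_k) : R := \sum_i x i 0 * y i 0.

Definition tuple_col k (y : k.-tuple R) : 'cV[R]_k := \col_i tnth y i.

Definition tuple_ball k (r : R) : set (k.-tuple R) :=
  [set y | norm2 (tuple_col y) <= r].

(* [theta, Z]; the ambient dimension n >= 1 is written m.+1 throughout. *)
Definition frame_mx (A : nzRingType) m (theta : 'cV[A]_m.+1)
    (Z : 'M[A]_(m.+1, m)) : 'M[A]_m.+1 :=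
  row_mx theta Z.

Definition orthogonal_group n : set 'M[R]_n := [set Q | Q^T *m Q = 1%:M].

(* Some Z completing the unit vector theta to an orthogonal matrix: its columns
   are an orthonormal basis of the orthogonal complement of theta. *)
Definition hyperplane_frame m (theta : 'cV[R]_m.+1) : 'M[R]_(m.+1, m) :=
  xget 0 [set Z | orthogonal_group (frame_mx theta Z)].

(* (n-1)-dimensional volume of a subset A of the hyperplane
   {x | theta . x = t}, theta a unit vector: Lebesgue measure transported along
   the isometry y |-> theta t + Z y from R^(n-1) onto the hyperplane. By rotation
   invariance of Lebesgue measure the choice of the frame Z is immaterial. *)
Definition hyperplane_volume m (theta : 'cV[R]_m.+1) (t : R)
    (A : set 'cV[R]_m.+1) : \bar R :=
  lebesgue_tuple
    [set y | A (t *: theta + hyperplane_frame theta *m tuple_col y)].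

End geometry.

Section polynomials.
Context {R : realType}.

Definition peval N (p : {mpoly R[N]}) (x : 'cV[R]_N) : R :=
  meval (fun i => x i 0) p.

(* The generic point (X_0, ..., X_(N-1)). *)
Definition vars N : 'cV[{mpoly R[N]}]_N := \col_i mpolyX R (mnm1 i).

Definition ball_poly N (r : R) : {mpoly R[N]} :=
  mpolyC N (r ^+ 2) - \sum_i vars N i 0 ^+ 2.

(* msize is the total degree plus one, and 0 for the zero polynomial. *)
Definition deg_le N (d : nat) (p : {mpoly R[N]}) : Prop :=
  (mpoly.msize p <= d.+1)%N.

Definition sos N (p : {mpoly R[N]}) : Prop :=
  exists s : seq {mpoly R[N]}, p = \sum_(q <- s) q ^+ 2.

Definition trunc_qmodule N (h : seq {mpoly R[N]}) (d : nat) :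
    set {mpoly R[N]} :=
  [set p | exists (sigma0 : {mpoly R[N]})
                  (sigma : 'I_(size h) -> {mpoly R[N]}),
    [/\ sos sigma0, deg_le d sigma0,
        forall j, sos (sigma j),
        forall j, deg_le d (sigma j * h`_j)
      & p = sigma0 + \sum_j sigma j * h`_j]].

Definition basic_semialgebraic N (h : seq {mpoly R[N]}) : set 'cV[R]_N :=
  [set x | forall p, p \in h -> 0 <= peval p x].

End polynomials.

(* A point (theta, t, Z) is stored as a column of length omega_dim m, with Z
   flattened row by row, and (theta, t, Z, y) as that column followed by y.
   The accessors apply to points over R as well as to columns of variables. *)
Definition omega_dim m : nat := (m.+1 + 1 + m.+1 * m)%N.

Definition psi_dim m : nat := (omega_dim m + m)%N.

Section coordinates.
Variables (A : nzRingType) (m : nat).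

Definition omega_theta (u : 'cV[A]_(omega_dim m)) : 'cV[A]_m.+1 :=
  usubmx (usubmx u).

Definition omega_t (u : 'cV[A]_(omega_dim m)) : A := dsubmx (usubmx u) 0 0.

Definition omega_Z (u : 'cV[A]_(omega_dim m)) : 'M[A]_(m.+1, m) :=
  vec_mx (dsubmx u)^T.

Definition psi_omega (v : 'cV[A]_(psi_dim m)) : 'cV[A]_(omega_dim m) :=
  usubmx v.

Definition psi_y (v : 'cV[A]_(psi_dim m)) : 'cV[A]_m := dsubmx v.

(* theta t + Z y *)
Definition psi_x (v : 'cV[A]_(psi_dim m)) : 'cV[A]_m.+1 :=
  let u := psi_omega v in
  omega_t u *: omega_theta u + omega_Z u *m psi_y v.

(* R^2 - t^2, and both signs of every entry of [theta, Z]^T [theta, Z] - I. *)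
Definition omega_constraints (r : A) (u : 'cV[A]_(omega_dim m)) : seq A :=
  let Q := frame_mx (omega_theta u) (omega_Z u) in
  let E := Q^T *m Q - 1%:M in
  let eqs := [seq E i j | i <- enum 'I_m.+1, j <- enum 'I_m.+1] in
  (r ^+ 2 - omega_t u ^+ 2) :: eqs ++ [seq - e | e <- eqs].

Definition psi_constraints (r : A) (v : 'cV[A]_(psi_dim m)) : seq A :=
  rcons (omega_constraints r (psi_omega v))
        (r ^+ 2 - \sum_j psi_y v j 0 ^+ 2).

End coordinates.

Section hierarchy.
Context {R : realType}.
Variables (m : nat) (r : R) (g : seq {mpoly R[m.+1]}).

Definition omega_polys : seq {mpoly R[omega_dim m]} :=
  omega_constraints (mpolyC (omega_dim m) r) (vars (omega_dim m)).

Definition psi_polys : seq {mpoly R[psi_dim m]} :=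
  psi_constraints (mpolyC (psi_dim m) r) (vars (psi_dim m)).

Definition psiL_polys : seq {mpoly R[psi_dim m]} :=
  psi_polys ++
  [seq comp_mpoly [tuple psi_x (vars (psi_dim m)) i 0 | i < m.+1] p | p <- g].

(* Lambda_R w at the point u = (theta, t, Z). *)
Definition Lambda (w : {mpoly R[psi_dim m]}) (u : 'cV[R]_(omega_dim m)) : R :=
  \int[@lebesgue_tuple R m]_(y in @tuple_ball R m r)
    peval w (col_mx u (tuple_col y)).

(* Real polynomials are identified with the functions they define: gamma -
   Lambda_R w is represented by the polynomial q taking the same values. *)
Definition feasible (k : nat) (gamma : R) (w : {mpoly R[psi_dim m]}) : Prop :=
  [/\ deg_le (2 * k) w,
      exists2 q, trunc_qmodule omega_polys (2 * k) q &
        forall u, peval q u = gamma - Lambda w u,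
      trunc_qmodule psiL_polys (2 * k) (w - 1)
    & trunc_qmodule psi_polys (2 * k) w].

Definition p_star (k : nat) : \bar R :=
  ereal_inf [set gamma%:E | gamma in [set gamma | exists w, feasible k gamma w]].

Definition P_star : \bar R :=
  ereal_sup [set V | exists (theta : 'cV[R]_m.+1) (t : R),
    [/\ norm2 theta = 1, - r <= t <= r
      & V = hyperplane_volume theta t
              (basic_semialgebraic g `&` [set x | dotp theta x = t])]].

End hierarchy.

Section description.
Context {R : realType}.
Variables (m : nat) (r : R) (g : seq {mpoly R[m.+1]}).

Definition Omega_Z : set 'cV[R]_(omega_dim m) :=
  [set u | - r <= omega_t u <= r /\
           orthogonal_group (frame_mx (omega_theta u) (omega_Z u))].

Definition Psi : set 'cV[R]_(psi_dim m) :=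
  [set v | Omega_Z (psi_omega v) /\ norm2 (psi_y v) <= r].

Definition Psi_L : set 'cV[R]_(psi_dim m) :=
  [set v | Psi v /\ basic_semialgebraic g (psi_x v)].

Let ev N (x : 'cV[R]_N) : {rmorphism {mpoly R[N]} -> R} :=
  [the {rmorphism _ -> _} of meval (fun i => x i 0)].

Let ev_vars N (x : 'cV[R]_N) : map_mx (ev x) (vars N) = x.
Proof. by apply/colP => i; rewrite !mxE /= mevalXU. Qed.

Let ev_omega N (x : 'cV[R]_N) (u : 'cV[{mpoly R[N]}]_(omega_dim m)) :
  [seq peval p x | p <- omega_constraints (mpolyC N r) u] =
  omega_constraints r (map_mx (ev x) u).
Proof.
rewrite /omega_constraints /= map_cat -!map_comp !map_allpairs.
have thE : omega_theta (map_mx (ev x) u) = map_mx (ev x) (omega_theta u).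
  by apply/matrixP => i j; rewrite !mxE.
have ZE : omega_Z (map_mx (ev x) u) = map_mx (ev x) (omega_Z u).
  by apply/matrixP => i j; rewrite !mxE.
have QE : frame_mx (omega_theta (map_mx (ev x) u)) (omega_Z (map_mx (ev x) u))
    = map_mx (ev x) (frame_mx (omega_theta u) (omega_Z u)).
  by rewrite thE ZE; exact/esym/(@map_row_mx _ _ (ev x) m.+1 1 m).
have EE i j : ev x (((frame_mx (omega_theta u) (omega_Z u))^T *m
      (frame_mx (omega_theta u) (omega_Z u)) - 1%:M) i j) =
    ((frame_mx (omega_theta (map_mx (ev x) u)) (omega_Z (map_mx (ev x) u)))^T *m
     (frame_mx (omega_theta (map_mx (ev x) u)) (omega_Z (map_mx (ev x) u)))
      - 1%:M) i j.
  rewrite QE map_trmx -map_mxM -(map_mx1 (ev x)) -map_mxB.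
  by rewrite [RHS]mxE.
congr cons.
  rewrite /peval -/(ev x) rmorphB !rmorphXn /= mevalC; congr (_ - _ ^+ 2).
  by rewrite /omega_t !mxE.
congr cat; apply: eq_allpairs => i j //=.
- by rewrite -EE.
- by rewrite /peval mevalN -EE.
Qed.

Let ev_psi (x : 'cV[R]_(psi_dim m)) :
  [seq peval p x | p <- psi_polys m r] = psi_constraints r x.
Proof.
rewrite /psi_polys /psi_constraints map_rcons ev_omega; congr rcons.
  by congr omega_constraints; rewrite -[in RHS](ev_vars x);
     apply/matrixP => i j; rewrite !mxE.
rewrite /peval -/(ev x) rmorphB rmorphXn rmorph_sum /= mevalC.
congr (_ - _); apply: eq_bigr => j _.
by rewrite rmorphXn /psi_y !mxE /= mevalXU.
Qed.

Let norm2_le k (y : 'cV[R]_k) : 0 < r ->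
  (norm2 y <= r) = (0 <= r ^+ 2 - \sum_j y j 0 ^+ 2).
Proof.
move=> r0; rewrite subr_ge0 /norm2 -[in LHS](ger0_norm (ltW r0)) -sqrtr_sqr.
by rewrite ler_sqrt// exprn_ge0// ltW.
Qed.

Let omega_constraintsP (u : 'cV[R]_(omega_dim m)) : 0 < r ->
  (forall c, c \in omega_constraints r u -> 0 <= c) <-> Omega_Z u.
Proof.
move=> r0; have tE : (0 <= r ^+ 2 - omega_t u ^+ 2) = (- r <= omega_t u <= r).
  by rewrite subr_ge0 -ler_norml -(real_normK (num_real (omega_t u)))
    ler_sqr// ?nnegrE ?normr_ge0// ltW.
rewrite /omega_constraints; set Q := frame_mx _ _; set s := (X in _ :: X ++ _).
split=> [H|[tr QQ] c].
  split; first by rewrite -tE; apply: H; rewrite mem_head.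
  apply/eqP; rewrite -subr_eq0; apply/eqP/matrixP => i j; rewrite [RHS]mxE.
  have ins : (Q^T *m Q - 1%:M) i j \in s.
    by apply/allpairsP; exists (i, j); rewrite !mem_enum.
  apply/eqP; rewrite eq_le -oppr_ge0 !H// inE mem_cat ?ins ?orbT//.
  by rewrite map_f ?orbT.
have s0 e : e \in s -> e = 0.
  by case/allpairsP => -[i j] /= [_ _ ->]; rewrite QQ subrr mxE.
rewrite inE mem_cat => /orP[/eqP ->|/orP[/s0 ->//|/mapP[e /s0 -> ->]]].
  by rewrite tE.
by rewrite oppr0.
Qed.

Let basic_map N (h : seq {mpoly R[N]}) (x : 'cV[R]_N) :
  basic_semialgebraic h x <->
  (forall c, c \in [seq peval p x | p <- h] -> 0 <= c).
Proof.
split=> [H _ /mapP[p /H p0 ->]//|H p hp]; apply: H; exact: map_f.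
Qed.

Lemma omega_polysE : 0 < r ->
  basic_semialgebraic (omega_polys m r) = Omega_Z.
Proof.
move=> r0; apply/seteqP; split=> u /=.
  by move/basic_map; rewrite ev_omega ev_vars => /omega_constraintsP; exact.
by move=> Hu; apply/basic_map; rewrite ev_omega ev_vars;
   exact/omega_constraintsP.
Qed.

Lemma psi_polysE : 0 < r -> basic_semialgebraic (psi_polys m r) = Psi.
Proof.
move=> r0; apply/predeqP => v.
rewrite basic_map ev_psi /psi_constraints; split=> [H|[Hv yr] c].
  split.
    by apply/omega_constraintsP => // c Hc; apply: H;
       rewrite mem_rcons inE Hc orbT.
  by rewrite /= norm2_le//; apply: H; rewrite mem_rcons mem_head.
rewrite mem_rcons inE => /orP[/eqP->|]; first by rewrite -norm2_le.
by move: c; exact/omega_constraintsP.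
Qed.

Lemma psiL_polysE : 0 < r -> basic_semialgebraic (psiL_polys r g) = Psi_L.
Proof.
move=> r0; apply/predeqP => v.
have gE p : peval
    (comp_mpoly [tuple psi_x (vars (psi_dim m)) i 0 | i < m.+1] p) v =
    peval p (psi_x v).
  rewrite /peval comp_mpoly_meval; apply: meval_eq => i.
  rewrite tnth_map tnth_ord_tuple.
  have -> : psi_x v = map_mx (ev v) (psi_x (vars (psi_dim m))).
    2: by rewrite [RHS]mxE.
  rewrite -[in LHS](ev_vars v) /psi_x /= map_mxD map_mxZ map_mxM.
  congr (_ + _); [congr (_ *: _)|congr mulmx].
  - by rewrite /omega_t !mxE.
  1-3: by apply/matrixP => a b; rewrite !mxE.
split=> [H|[]].
  split; first by rewrite -psi_polysE// => p hp; apply: H; rewrite mem_cat hp.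
  by move=> p gp; rewrite -gE; apply: H; rewrite mem_cat map_f ?orbT.
rewrite -psi_polysE// => H1 H2 p; rewrite mem_cat => /orP[/H1//|/mapP[q gq ->]].
by rewrite gE; exact: H2.
Qed.

End description.

(* Main.v *)
(* For gamma feasible at level k, w >= 1 on Psi_L and w >= 0 on Psi bound the
   volume of each slice {y | theta t + Z y in L} by Lambda_R w <= gamma; this
   gives P* <= p_k*.  Volumes of slices do not depend on the frame Z because
   Lebesgue measure is invariant under orthogonal maps (uniqueness of Haar
   measure).
   Conversely, with G the sum of the negative parts min(0, g_i) the functions
   max(0, 1 + k G) decrease pointwise on Psi to the indicator of Psi_L.  They
   are lattice combinations of polynomials, so (Weierstrass approximation of
   the absolute value) there are polynomials w_k > 0 on Psi, w_k > 1 on Psi_L,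
   decreasing to that indicator.  For c > P*, a Dini argument (compactness of
   Omega_Z and dominated convergence) gives k with Lambda_R w_k < c on Omega_Z,
   and Putinar's Positivstellensatz, applied three times, turns the strict
   inequalities into certificates of some finite degree.
   Putinar's theorem is obtained from Jacobi's representation theorem: a maximal
   proper archimedean quadratic module is the nonnegativity set of a character. *)
Require Import Defs.
From HB Require Import structures.
From mathcomp Require Import all_boot all_order all_algebra ring lra.
From mathcomp Require Import -(notations) mpoly.
From mathcomp Require Import all_classical all_reals all_analysis.
From mathcomp Require Import measurable_realfun.

Set Implicit Arguments.
Unset Strict Implicit.
Unset Printing Implicit Defensive.

Import Order.TTheory GRing.Theory Num.Theory.
Import numFieldNormedType.Exports.

Local Open Scope classical_set_scope.
Local Open Scope ring_scope.

(** * Archimedean quadratic modules *)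

Section quadratic_module.
Context {R : realType} {A : comAlgType R}.
Implicit Types (Q : set A) (p q a s t : A) (c : R).

Definition sumsq : set A :=
  [set s | exists l : seq A, s = \sum_(q <- l) q ^+ 2].

Definition quadratic_module Q :=
  [/\ Q 1, forall p q, Q p -> Q q -> Q (p + q)
    & forall a p, Q p -> Q (a ^+ 2 * p)].

(** A one-sided bound suffices: [p] ranges over all of [A], and the bound for [- p] is the lower
    bound for [p]. *)
Definition archimedean Q := forall p, exists c, Q (c%:A - p).

(** For a quadratic module [Q], this is the smallest quadratic module containing both [Q] and
    [a]. *)
Definition adjoin Q a : set A :=
  [set p | exists q s, [/\ Q q, sumsq s & p = q + s * a]].

Lemma sumsq0 : sumsq 0.
Proof. by exists [::]; rewrite big_nil. Qed.

Lemma sumsqX a : sumsq (a ^+ 2).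
Proof. by exists [:: a]; rewrite big_seq1. Qed.

Lemma sumsqD s t : sumsq s -> sumsq t -> sumsq (s + t).
Proof. by move=> [l ->] [k ->]; exists (l ++ k); rewrite big_cat. Qed.

Lemma sumsqXM a s : sumsq s -> sumsq (a ^+ 2 * s).
Proof.
move=> [l ->]; exists [seq a * x | x <- l]; rewrite big_map mulr_sumr.
by apply: eq_bigr => x _; rewrite exprMn.
Qed.

Section theory.
Variable Q : set A.
Hypothesis qmQ : quadratic_module Q.

Lemma qmoduleD p q : Q p -> Q q -> Q (p + q).
Proof. by case: qmQ => _ + _; apply. Qed.

Lemma qmoduleXM a p : Q p -> Q (a ^+ 2 * p).
Proof. by case: qmQ => _ _; apply. Qed.

Lemma qmodule1 : Q 1.
Proof. by case: qmQ. Qed.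

Lemma qmodule0 : Q 0.
Proof. by have := qmoduleXM 0 qmodule1; rewrite expr0n mul0r. Qed.

Lemma qmoduleX a : Q (a ^+ 2).
Proof. by rewrite -[X in Q X]mulr1; exact/qmoduleXM/qmodule1. Qed.

Lemma qmodule_sumsqM s p : sumsq s -> Q p -> Q (s * p).
Proof.
move=> [l ->] hp; elim: l => [|x l ih].
  by rewrite big_nil mul0r; exact: qmodule0.
by rewrite big_cons mulrDl; apply: qmoduleD => //; exact: qmoduleXM.
Qed.

Lemma qmodule_sumsq s : sumsq s -> Q s.
Proof. by move=> hs; rewrite -[s]mulr1; exact/qmodule_sumsqM/qmodule1. Qed.

Lemma qmoduleZ c p : 0 <= c -> Q p -> Q (c *: p).
Proof.
move=> c0 hp; rewrite -mulr_algl -[c]sqr_sqrtr// expr2.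
rewrite (_ : (_ * _)%:A = (Num.sqrt c)%:A ^+ 2 :> A); first exact: qmoduleXM.
by rewrite expr2 mulr_algl scalerA.
Qed.

Lemma qmoduleZV c p : 0 < c -> Q (c *: p) -> Q p.
Proof.
move=> c0 h; have := qmoduleZ (ltW (_ : 0 < c^-1)) h.
by rewrite scalerA mulVf ?gt_eqF// scale1r invr_gt0; exact.
Qed.

Lemma qmodule_alg c : 0 <= c -> Q c%:A.
Proof. by move=> c0; exact/qmoduleZ/qmodule1. Qed.

Lemma qmodule_le c d p : c <= d -> Q (c%:A + p) -> Q (d%:A + p).
Proof.
move=> cd h; have -> : d%:A + p = (d - c)%:A + (c%:A + p).
  by rewrite scalerBl addrA subrK.
by apply: qmoduleD => //; apply: qmodule_alg; rewrite subr_ge0.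
Qed.

Lemma qmodule_adjoin a : quadratic_module (adjoin Q a).
Proof.
split=> [|p q [x [s [Qx ss ->]]] [y [t [Qy tt ->]]]|b p [x [s [Qx ss ->]]]].
- exists 1, 0; split; [exact: qmodule1|exact: sumsq0|by rewrite mul0r addr0].
- exists (x + y), (s + t); split; [exact: qmoduleD|exact: sumsqD|ring].
- exists (b ^+ 2 * x), (b ^+ 2 * s).
  by split; [exact: qmoduleXM|exact: sumsqXM|ring].
Qed.

Lemma sub_adjoin a : Q `<=` adjoin Q a.
Proof.
move=> p Qp; exists p, 0; split => //; [exact: sumsq0|].
by rewrite mul0r addr0.
Qed.

Lemma adjoin_mem a : adjoin Q a a.
Proof.
exists 0, 1; split; first exact: qmodule0.
  by rewrite -(expr1n _ 2); exact: sumsqX.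
by rewrite mul1r add0r.
Qed.

(** The identity $2e(e^2-a^2)=(e-a)^2(e+a)+(e+a)^2(e-a)$, after which the positive scalar $2e$ is
    cancelled. *)
Lemma qmodule_sqrB e a : 0 < e -> Q (e%:A - a) -> Q (e%:A + a) ->
  Q ((e ^+ 2)%:A - a ^+ 2).
Proof.
move=> e0 h1 h2; apply: (@qmoduleZV (e + e)); first exact: addr_gt0.
rewrite -[X in Q X]mulr_algl scalerDl [e ^+ 2]expr2 -(scalerA e e) -[e *: e%:A]mulr_algl.
set x : A := e%:A in h1 h2 *.
rewrite (_ : _ * _ = (x - a) ^+ 2 * (x + a) + (x + a) ^+ 2 * (x - a)); last by ring.
by apply: qmoduleD; exact: qmoduleXM.
Qed.

(** These elements turn out to form a subalgebra, which reduces the archimedean property to algebra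
    generators. *)
Definition qbounded : set A := [set p | exists c, Q (c%:A - p) /\ Q (c%:A + p)].

Lemma qbounded_gt0 p : qbounded p ->
  exists2 c, 0 < c & Q (c%:A - p) /\ Q (c%:A + p).
Proof.
move=> [c [h1 h2]]; exists (`|c| + 1); first by rewrite ltr_wpDl.
have cle : c <= `|c| + 1 by rewrite (le_trans (ler_norm _))// lerDl.
by split; [exact: (qmodule_le cle h1)|exact: (qmodule_le cle h2)].
Qed.

Lemma qboundedD p q : qbounded p -> qbounded q -> qbounded (p + q).
Proof.
move=> [c [h1 h2]] [d [k1 k2]]; exists (c + d); rewrite !scalerDl.
by split; [rewrite opprD addrACA|rewrite addrACA]; exact: qmoduleD.
Qed.

Lemma qboundedZ k p : qbounded p -> qbounded (k *: p).
Proof.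
move=> [c [h1 h2]]; exists (`|k| * c).
have [k0|k0] := leP 0 k.
  by rewrite ger0_norm// -scalerA -scalerBr -scalerDr; split; exact: qmoduleZ.
rewrite ltr0_norm// -scalerA -[k *: p]opprK -scaleNr opprK -scalerBr -scalerDr.
by split; apply: qmoduleZ => //; rewrite oppr_ge0 ltW.
Qed.

Lemma qbounded_sqr p : qbounded p -> qbounded (p ^+ 2).
Proof.
move=> /qbounded_gt0[c c0 [h1 h2]]; exists (c ^+ 2); split.
  exact: qmodule_sqrB.
by apply: qmoduleD; [exact/qmodule_alg/sqr_ge0|exact: qmoduleX].
Qed.

(** Polarization reduces products to squares. *)
Lemma qboundedM p q : qbounded p -> qbounded q -> qbounded (p * q).
Proof.
move=> hp hq.
have -> : p * q = (4^-1 : R) *: ((p + q) ^+ 2 + (-1 : R) *: (p + (-1 : R) *: q) ^+ 2).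
  rewrite !scaleN1r (_ : (p + q) ^+ 2 - _ = p * q *+ 4); last by ring.
  by rewrite -[p * q *+ 4](@scaler_nat R) scalerA mulVf ?scale1r// pnatr_eq0.
apply/qboundedZ/qboundedD; first exact/qbounded_sqr/qboundedD.
by apply/qboundedZ/qbounded_sqr/qboundedD => //; exact: qboundedZ.
Qed.

Lemma qbounded_alg c : qbounded c%:A.
Proof.
exists `|c|; split.
  by rewrite -scalerBl; apply: qmodule_alg; rewrite subr_ge0 ler_norm.
rewrite -scalerDl; apply: qmodule_alg.
by have := ler_norm (- c); rewrite normrN -lerBlDr sub0r.
Qed.

(** Completing the square: $\frac14+c\pm p=(\frac12\pm p)^2+(c-p^2)$. *)
Lemma qbounded_of_sqr c p : Q (c%:A - p ^+ 2) -> qbounded p.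
Proof.
move=> h; exists (4^-1 + c); rewrite scalerDl.
have e : (4^-1 : R)%:A = ((2^-1 : R)%:A) ^+ 2 :> A.
  by rewrite expr2 mulr_algl scalerA -invfM -natrM.
have f : (2^-1 : R)%:A + (2^-1 : R)%:A = 1 :> A.
  by rewrite -scalerDl (_ : 2^-1 + 2^-1 = 1 :> R) ?scale1r//; lra.
rewrite e; set x : A := (2^-1)%:A in e f *; set y : A := c%:A in h *.
(* [ring] cannot use the relation [f], so the factor $1=x+x$ is inserted by hand. *)
have pE : p = (x + x) * p by rewrite f mul1r.
split.
  rewrite (_ : _ - _ = (x - p) ^+ 2 + (y - p ^+ 2)); last by rewrite {1}pE; ring.
  by apply: qmoduleD => //; exact: qmoduleX.
rewrite (_ : _ + _ = (x + p) ^+ 2 + (y - p ^+ 2)); last by rewrite {1}pE; ring.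
by apply: qmoduleD => //; exact: qmoduleX.
Qed.

End theory.

(** * Maximal proper archimedean quadratic modules and the homomorphism they define *)

Section maximal.
Variable Q : set A.
Hypotheses (qmQ : quadratic_module Q) (arQ : archimedean Q) (Q_1 : ~ Q (-1)).
Hypothesis maxQ : forall P, quadratic_module P -> Q `<=` P -> ~ P (-1) -> P `<=` Q.

(** $Q\cap-Q$ is an ideal, by $4bx=(b+1)^2x+(b-1)^2(-x)$. *)
Let idealM a b : Q a -> Q (- a) -> Q (b * a) /\ Q (- (b * a)).
Proof.
move=> h1 h2.
have aux x : Q x -> Q (- x) -> Q (b * x).
  move=> k1 k2; apply: (@qmoduleZV _ qmQ 4) => //.
  rewrite scaler_nat.
  rewrite (_ : _ *+ 4 = (b + 1) ^+ 2 * x + (b - 1) ^+ 2 * (- x)); last by ring.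
  by apply: qmoduleD => //; exact: qmoduleXM.
by split; [|rewrite -mulrN]; apply: aux; rewrite ?opprK.
Qed.

(** If both fail, maximality puts $-1$ in both adjunctions: $-1=s_1+t_1a=s_2-t_2a$. Eliminating $a$
    gives $-t_1=t_2+t_1s_2+t_2s_1\in Q$, so $t_1\in Q\cap-Q$. This is an ideal, hence $t_1a\in Q$
    and $-1=s_1+t_1a\in Q$, a contradiction. *)
Lemma qmodule_max_total a : Q a \/ Q (- a).
Proof.
apply: contrapT => /not_orP[na nNa].
have key b : ~ Q b -> exists q s, [/\ Q q, sumsq s & -1 = q + s * b].
  move=> nb; apply: contrapT => h; apply: nb.
  by have /(_ b (adjoin_mem qmQ b)) := maxQ (qmodule_adjoin qmQ b) (@sub_adjoin _ b) h.
have [s1 [t1 [Qs1 st1 e1]]] := key _ na.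
have [s2 [t2 [Qs2 st2 e2]]] := key _ nNa.
have e1' : t1 * a = -1 - s1 by rewrite e1 addrC addKr.
have e2' : t2 * a = 1 + s2.
  by apply/eqP; rewrite -subr_eq0; move/eqP: e2; rewrite -subr_eq0 => /eqP <-; apply/eqP; ring.
have e : - t1 = t2 + t1 * s2 + t2 * s1.
  have : t2 * (t1 * a) = t1 * (t2 * a) by ring.
  rewrite e1' e2' => /eqP; rewrite -subr_eq0 => /eqP h.
  by apply/eqP; rewrite -subr_eq0 -h; apply/eqP; ring.
have Qt : Q (- t1).
  rewrite e; apply: qmoduleD => //; first apply: qmoduleD => //.
  - exact: qmodule_sumsq.
  - exact: qmodule_sumsqM.
  - exact: qmodule_sumsqM.
have [+ _] := idealM a (qmodule_sumsq qmQ st1) Qt.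
rewrite mulrC => /(qmoduleD qmQ Qs1).
by rewrite e1' addrCA subrr addr0.
Qed.

Let up a := [set c : R | Q (c%:A - a)].

Lemma qmodule_algP c : Q c%:A -> 0 <= c.
Proof.
move=> h; rewrite leNgt; apply/negP => c0; apply: Q_1.
apply: (@qmoduleZV _ qmQ (- c)); first by rewrite oppr_gt0.
by rewrite scalerN -scaleNr opprK.
Qed.

Let up_nonempty a : up a !=set0.
Proof. by have [c h] := arQ a; exists c. Qed.

Let up_lb a : has_lbound (up a).
Proof.
have [d] := arQ (- a); rewrite opprK => hd.
exists (- d) => c hc; rewrite -subr_ge0 opprK; apply: qmodule_algP.
rewrite scalerDl (_ : _ + _ = (c%:A - a) + (d%:A + a)); last by ring.
exact: qmoduleD.
Qed.

(** By totality, the scalars above [a] and those below [a] in the order of [Q] form a Dedekind cut;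
    this is the real number it defines. *)
Definition qhom a : R := inf (up a).

Lemma qhom_lt a c : qhom a < c -> Q (c%:A - a).
Proof.
move=> /(inf_lt (up_nonempty a))[d hd dc].
exact: (qmodule_le qmQ (ltW dc)).
Qed.

Lemma qhom_le a c : Q (c%:A - a) -> qhom a <= c.
Proof. by move=> h; apply: ge_inf => //; exact: up_lb. Qed.

Lemma qhom_ge a c : Q (a - c%:A) -> c <= qhom a.
Proof.
move=> h; apply: lb_le_inf; first exact: up_nonempty.
move=> d hd; rewrite -subr_ge0; apply: qmodule_algP.
rewrite scalerBl (_ : _ - _ = (d%:A - a) + (a - c%:A)); last by ring.
exact: qmoduleD.
Qed.

Lemma qhom_gt a c : c < qhom a -> Q (a - c%:A).
Proof.
move=> h; have [|] := qmodule_max_total (a - c%:A) => //.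
by rewrite opprB => /qhom_le; rewrite leNgt h.
Qed.

Lemma qhom_ge0 a : Q a -> 0 <= qhom a.
Proof. by move=> h; apply: qhom_ge; rewrite scale0r subr0. Qed.

Let qhom_eq a c : (forall e, 0 < e -> Q ((c + e)%:A - a) /\ Q (a - (c - e)%:A)) ->
  qhom a = c.
Proof.
move=> h; apply/eqP; rewrite eq_le; apply/andP; split.
  by apply/ler_addgt0Pr => e e0; apply: qhom_le; exact: (h _ e0).1.
apply/ler_addgt0Pr => e e0; rewrite -lerBlDr; apply: qhom_ge; exact: (h _ e0).2.
Qed.

Let qhomP a e : 0 < e ->
  Q ((qhom a + e)%:A - a) /\ Q (a - (qhom a - e)%:A).
Proof.
by move=> e0; split; [apply: qhom_lt; rewrite ltrDl|apply: qhom_gt; rewrite gtrBl].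
Qed.

Lemma qhomD a b : qhom (a + b) = qhom a + qhom b.
Proof.
apply: qhom_eq => e e0; have e20 : 0 < e / 2 by rewrite divr_gt0.
have [a1 a2] := qhomP a e20; have [b1 b2] := qhomP b e20.
have -> : qhom a + qhom b + e = (qhom a + e / 2) + (qhom b + e / 2).
  by lra.
have -> : qhom a + qhom b - e = (qhom a - e / 2) + (qhom b - e / 2).
  by lra.
rewrite !(scalerDl _ (qhom a + _)) ?(scalerDl _ (qhom a - _)).
by split; [rewrite opprD addrACA|rewrite opprD addrACA]; exact: qmoduleD.
Qed.

Lemma qhom_alg c : qhom c%:A = c.
Proof.
apply: qhom_eq => e e0; rewrite -!scalerBl.
by split; apply: qmodule_alg => //; lra.
Qed.

Lemma qhomN a : qhom (- a) = - qhom a.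
Proof.
apply/eqP; rewrite -addr_eq0 addrC -qhomD subrr.
by have := qhom_alg 0; rewrite scale0r => ->.
Qed.

(** From $-\sqrt e\le a\le\sqrt e$ in the order of [Q] follows $a^2\le e$. Multiplicativity of
    [qhom] rests on this case. *)
Let qhom_sqr0 a : qhom a = 0 -> qhom (a ^+ 2) = 0.
Proof.
move=> a0; apply: qhom_eq => e e0; rewrite !add0r; split.
  rewrite -[e]sqr_sqrtr ?ltW//.
  have s0 : 0 < Num.sqrt e by rewrite sqrtr_gt0.
  apply: qmodule_sqrB => //; first by apply: qhom_lt; rewrite a0.
  have : Q (a - (- Num.sqrt e)%:A) by apply: qhom_gt; rewrite a0 oppr_lt0.
  by rewrite scaleNr opprK addrC.
rewrite scaleNr opprK; apply: qmoduleD => //; first exact: qmoduleX.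
by apply: qmodule_alg => //; exact: ltW.
Qed.

Let qhomZ_sub c a : qhom a = 0 -> qhom (c *: a) = 0.
Proof.
move=> a0.
have pos k : 0 < k -> qhom (k *: a) = 0.
  move=> k0; apply: qhom_eq => e e0; rewrite add0r.
  have ek : 0 < e / k by rewrite divr_gt0.
  have [h1 h2] := qhomP a ek; rewrite a0 add0r sub0r in h1 h2; split.
    rewrite -[e](divfK (lt0r_neq0 k0)) mulrC -scalerA -scalerBr.
    by apply: qmoduleZ => //; exact: ltW.
  rewrite sub0r -[e](divfK (lt0r_neq0 k0)) mulrC -mulrN -scalerA -scalerBr.
  by apply: qmoduleZ => //; exact: ltW.
have [c0|c0|->] := ltgtP c 0; last 2 first.
- exact: pos.
- by rewrite scale0r -(scale0r 1) qhom_alg.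
by rewrite -[c]opprK scaleNr qhomN pos ?oppr0// oppr_gt0.
Qed.

Let qhom_shift a : qhom (a - (qhom a)%:A) = 0.
Proof. by rewrite qhomD qhomN qhom_alg subrr. Qed.

Lemma qhomZ c a : qhom (c *: a) = c * qhom a.
Proof.
rewrite -[a in LHS](subrK (qhom a)%:A) scalerDr qhomD qhomZ_sub ?qhom_shift//.
by rewrite add0r scalerA qhom_alg.
Qed.

(** With $c$ the value at $a$, write $a^2=(a-c)^2+2ca-c^2$; the value of $a-c$, hence of its square,
    is zero. *)
Lemma qhom_sqr a : qhom (a ^+ 2) = qhom a ^+ 2.
Proof.
set c := qhom a.
have -> : a ^+ 2 = (a - c%:A) ^+ 2 + (2 * c) *: a + (- c ^+ 2)%:A.
  have -> : (- c ^+ 2)%:A = - (c%:A * c%:A) :> A.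
    by rewrite scaleNr expr2 mulr_algl scalerA.
  by rewrite -scalerA scaler_nat -[c *: a]mulr_algl; ring.
by rewrite !qhomD qhom_sqr0 ?qhom_shift// qhom_alg qhomZ -/c add0r; ring.
Qed.

Lemma qhomM a b : qhom (a * b) = qhom a * qhom b.
Proof.
have := qhom_sqr (a + b); rewrite sqrrD !qhomD !qhom_sqr.
rewrite sqrrD => /eqP.
rewrite -subr_eq0 => /eqP h; apply/eqP; rewrite -subr_eq0.
have: (2 : R) * (qhom (a * b) - qhom a * qhom b) = 0 by rewrite -h; ring.
by move=> /eqP; rewrite mulf_eq0 pnatr_eq0.
Qed.

End maximal.

(** * Characters and the representation theorem *)

Definition is_character (f : A -> R) :=
  [/\ forall c, f c%:A = c, forall a b, f (a + b) = f a + f b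
    & forall a b, f (a * b) = f a * f b].

Lemma character_exists Q : quadratic_module Q -> archimedean Q -> ~ Q (-1) ->
  exists2 f, is_character f & forall a, Q a -> 0 <= f a.
Proof.
move=> qmQ arQ Q_1.
(* Zorn's lemma also asks about the empty chain, whose union is empty. Working with the unions of
   [S] and [Q] makes that case yield [Q] itself. *)
pose P := [set S | [/\ quadratic_module (S `|` Q) & ~ (S `|` Q) (-1)]].
have [|M [[qmM M_1] maxM]] := @Zorn_bigcup _ P.
- move=> F FP totF; split; last first.
    by case=> [[S FS S1]|//]; have [_] := FP _ FS; apply; left.
  have sub S : F S -> S `|` Q `<=` (\bigcup_(X in F) X) `|` Q.
    by move=> FS p [Sp|Qp]; [left; exists S|right].
  split; first by right; exact: qmodule1.
    move=> p q [[S FS Sp]|Qp] [[T FT Tq]|Qq].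
    + have [ST|TS] := totF _ _ FS FT.
        by apply: (sub T FT); apply: (qmoduleD (FP _ FT).1); left => //; exact: ST.
      by apply: (sub S FS); apply: (qmoduleD (FP _ FS).1); left => //; exact: TS.
    + by apply: (sub S FS); apply: (qmoduleD (FP _ FS).1); [left|right].
    + by apply: (sub T FT); apply: (qmoduleD (FP _ FT).1); [right|left].
    + by right; exact: qmoduleD.
  move=> a p [[S FS Sp]|Qp]; last by right; exact: qmoduleXM.
  by apply: (sub S FS); apply: (qmoduleXM (FP _ FS).1); left.
have maxMQ T : quadratic_module T -> M `|` Q `<=` T -> ~ T (-1) -> T `<=` M `|` Q.
  move=> qmT MT T_1; apply: contrapT => nTM.
  have TQ : T `|` Q = T by apply/setUidPl => p Qp; apply: MT; right.
  have PT : P T by rewrite /P /mkset TQ.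
  apply: (maxM T) => //; split; first by move=> p Mp; apply: MT; left.
  by move=> TM; apply: nTM => p /TM Mp; left.
have arM : archimedean (M `|` Q) by move=> p; have [c h] := arQ p; exists c; right.
exists (qhom (M `|` Q)); last first.
  by move=> a Qa; apply: qhom_ge0 => //; right.
by split; [exact: qhom_alg|exact: qhomD|exact: qhomM].
Qed.

(** Some $r+a$ lies in $Q$; the constant $r$ is lowered by $k^{-2}$ at a time until it is
    nonpositive. One step is the identity $k^2(r+a)-1=(k-s)^2(r+a)+2k(sa-1)+rs(2k-s)+(2k-1-s^2a)$,
    whose four terms lie in $Q$ when $r\ge0$ and $k$ is large. *)
Lemma jacobi_descent Q a s : quadratic_module Q -> archimedean Q -> sumsq s ->
  Q (s * a - 1) -> Q a.
Proof.
move=> qmQ arQ ss h.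
have [c1 h1] := arQ s; have [c2 h2] := arQ (1 + s ^+ 2 * a).
pose k := `|c1| + `|c2| + 1.
have k0 : 0 < k by rewrite ltr_wpDl// addr_ge0.
have h1' : Q ((2 * k)%:A - s).
  apply: qmodule_le h1 => //; have := ler_norm c1; have := normr_ge0 c1.
  by have := normr_ge0 c2; rewrite /k; lra.
have h2' : Q ((2 * k)%:A - (1 + s ^+ 2 * a)).
  apply: qmodule_le h2 => //; have := ler_norm c2; have := normr_ge0 c1.
  by have := normr_ge0 c2; rewrite /k; lra.
have step r : 0 <= r -> Q (r%:A + a) -> Q ((r - (k ^+ 2)^-1)%:A + a).
  move=> r0 hr; apply: (@qmoduleZV _ qmQ (k ^+ 2)); first exact: exprn_gt0.
  rewrite scalerDr scalerA mulrBr divff ?expf_neq0 ?gt_eqF//.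
  have E1 : ((k ^+ 2 * r - 1)%:A : A) = k%:A ^+ 2 * r%:A - 1.
    by rewrite scalerBl scale1r -scalerA -[k ^+ 2]/(k * k) -scalerA expr2 -!mulrA !mulr_algl.
  have E2 : k ^+ 2 *: a = k%:A ^+ 2 * a.
    by rewrite -[k ^+ 2]/(k * k) -scalerA expr2 -mulrA !mulr_algl.
  have E3 : (2 * k)%:A = 2 * k%:A :> A.
    by rewrite -scalerA scaler_nat mulr_natl.
  rewrite E1 E2; rewrite E3 in h1' h2'.
  have -> : k%:A ^+ 2 * r%:A - 1 + k%:A ^+ 2 * a =
     (k%:A - s) ^+ 2 * (r%:A + a) + (2 * k)%:A * (s * a - 1)
     + (r *: (s * (2 * k%:A - s))) + (2 * k%:A - (1 + s ^+ 2 * a)).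
    by rewrite E3 -[r *: (s * _)]mulr_algl; ring.
  apply: qmoduleD => //; apply: qmoduleD => //; first apply: qmoduleD => //.
  - exact: qmoduleXM.
  - by rewrite mulr_algl; apply: qmoduleZ => //; rewrite mulr_ge0// ltW.
  - by apply: qmoduleZ => //; exact: qmodule_sumsqM.
have [c] := arQ (- a); rewrite opprK => hc.
pose d := (k ^+ 2)^-1; have d0 : 0 < d by rewrite invr_gt0 exprn_gt0.
(* The alternative [r < 0] is kept because [step] applies only to nonnegative [r]; once [r] is
   negative the descent stops. *)
have main n : exists r : R, [/\ r <= `|c| - n%:R * d \/ r < 0 & Q (r%:A + a)].
  elim: n => [|n [r [hr Qr]]].
    exists `|c|; split; first by left; rewrite mul0r subr0.
    by apply: qmodule_le hc => //; exact: ler_norm.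
  have [r0|r0] := leP 0 r; last by exists r; split => //; right.
  exists (r - d); split; last exact: step.
  by left; case: hr => hr; [rewrite -natr1; lra|lra].
have [r [hr Qr]] := main (Num.trunc (`|c| / d)).+1.
suff : r <= 0.
  by move=> r0; have := qmodule_le qmQ r0 Qr; rewrite scale0r add0r.
case: hr => [hr|/ltW//]; apply: le_trans hr _; rewrite subr_le0.
by rewrite -ler_pdivrMr// ltW// truncnS_gt.
Qed.

(* Jacobi's form of the Kadison-Dubois theorem. *)
Theorem jacobi Q a : quadratic_module Q -> archimedean Q ->
  (forall f, is_character f -> (forall b, Q b -> 0 <= f b) -> 0 < f a) -> Q a.
Proof.
move=> qmQ arQ pos.
(* Either $-1=q-sa$, so that $sa-1=q\in Q$ and the descent applies, or adjoining $-a$ leaves a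
   proper module and some character nonnegative on [Q] has $f(a)\le0$. *)
have [[q [s [Qq ss e]]]|h] := pselect (adjoin Q (- a) (-1)).
  apply: (jacobi_descent qmQ arQ ss).
  rewrite (_ : _ - 1 = q) // e; ring.
have arA : archimedean (adjoin Q (- a)).
  by move=> p; have [c hc] := arQ p; exists c; exact: sub_adjoin.
have [f fch fpos] := character_exists (qmodule_adjoin qmQ _) arA h.
have fa : 0 < f a by apply: pos => // b Qb; apply: fpos; exact: sub_adjoin.
have := fpos _ (adjoin_mem qmQ (- a)).
case: fch => f1 fD fM; have : f (- a) + f a = 0.
  by rewrite -fD addNr -(scale0r 1) f1.
by move=> /eqP; rewrite addr_eq0 => /eqP ->; rewrite oppr_ge0 leNgt fa.
Qed.

End quadratic_module.

(** * Putinar's Positivstellensatz *)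

Section putinar.
Context {R : realType} {N : nat}.
Implicit Types (p q : {mpoly R[N]}) (h : seq {mpoly R[N]}) (x : 'cV[R]_N).

Lemma pevalD p q x : peval (p + q) x = peval p x + peval q x.
Proof. exact: mevalD. Qed.

Lemma pevalN p x : peval (- p) x = - peval p x.
Proof. exact: mevalN. Qed.

Lemma pevalB p q x : peval (p - q) x = peval p x - peval q x.
Proof. exact: mevalB. Qed.

Lemma pevalM p q x : peval (p * q) x = peval p x * peval q x.
Proof. exact: mevalM. Qed.

Lemma pevalZ c p x : peval (c *: p) x = c * peval p x.
Proof. exact: mevalZ. Qed.

Lemma peval1 x : peval 1 x = 1.
Proof. exact: meval1. Qed.

Lemma peval0 x : peval 0 x = 0.
Proof. exact: meval0. Qed.

Lemma pevalA c x : peval c%:A x = c.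
Proof. by rewrite pevalZ peval1 mulr1. Qed.

Lemma pevalXn p n x : peval (p ^+ n) x = peval p x ^+ n.
Proof. by elim: n => [|n ih]; rewrite ?expr0 ?peval1// !exprS pevalM ih. Qed.

Lemma peval_sum I (s : seq I) (P : pred I) (F : I -> {mpoly R[N]}) x :
  peval (\sum_(i <- s | P i) F i) x = \sum_(i <- s | P i) peval (F i) x.
Proof. exact: raddf_sum. Qed.

Lemma pevalX i x : peval (mpolyX R (mnm1 i)) x = x i 0.
Proof. exact: mevalXU. Qed.

(** The point is the vector of images of the variables, which generate the algebra. *)
Lemma character_peval (f : {mpoly R[N]} -> R) : is_character f ->
  exists x, forall p, f p = peval p x.
Proof.
move=> [f1 fD fM]; exists (\col_i f (mpolyX R (mnm1 i))).
have f11 : f 1 = 1 by rewrite -(scale1r 1) f1.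
elim/mpolyind => [|c m p _ _ ih].
  by rewrite peval0 -(scale0r 1) f1.
rewrite fD pevalD ih -mulr_algl fM f1 pevalM pevalA; congr (_ * _ + _).
rewrite mpolyXE_id (big_morph f fM f11) {1}/peval rmorph_prod.
apply: eq_bigr => i _; rewrite rmorphXn /= mevalXU mxE.
by elim: (m i) => [|n ihn]; rewrite ?expr0// !exprS fM ihn.
Qed.

Lemma mpoly_archimedean (Q : set {mpoly R[N]}) : quadratic_module Q ->
  (forall i, exists c : R, Q (c%:A - (mpolyX R (mnm1 i)) ^+ 2)) -> archimedean Q.
Proof.
move=> qmQ hX p; suff [c [hc _]] : qbounded Q p by exists c.
elim/mpolyind: p => [|c m p _ _ ih].
  by rewrite -(scale0r 1); exact: qbounded_alg.
apply: qboundedD => //; apply: qboundedZ => //; rewrite mpolyXE_id.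
have b1 : qbounded Q 1 by rewrite -(scale1r 1); exact: qbounded_alg.
elim/big_ind : _ => // [q q' hq hq'|i _]; first exact: qboundedM.
elim: (m i) => [|n ihn]; first by rewrite expr0.
rewrite exprS; apply: qboundedM => //.
by have [d hd] := hX i; exact: qbounded_of_sqr hd.
Qed.

Lemma trunc_qmodule_le h d d' : (d <= d')%N ->
  trunc_qmodule h d `<=` trunc_qmodule h d'.
Proof.
move=> dd' p [s0 [s [h1 h2 h3 h4 h5]]]; exists s0, s; split => //.
- by apply: leq_trans h2 _; rewrite ltnS.
- by move=> j; apply: leq_trans (h4 j) _; rewrite ltnS.
Qed.

Lemma trunc_qmodule_ge0 h d p x : trunc_qmodule h d p ->
  basic_semialgebraic h x -> 0 <= peval p x.
Proof.
have sos0 q : sos q -> 0 <= peval q x.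
  move=> [l ->]; rewrite peval_sum; apply: sumr_ge0 => i _.
  by rewrite pevalXn sqr_ge0.
move=> [s0 [s [h1 _ h2 _ ->]]] hx; rewrite pevalD peval_sum addr_ge0 ?sos0//.
apply: sumr_ge0 => j _; rewrite pevalM.
apply: mulr_ge0; first exact: sos0.
exact: (hx _ (mem_nth 0 (ltn_ord j))).
Qed.

(** The full quadratic module generated by [h]: the union of its truncations over all degrees. *)
Definition qmodule_of h : set {mpoly R[N]} :=
  [set p | exists d, trunc_qmodule h d p].

Lemma qmodule_ofP h p : qmodule_of h p <->
  exists s0 (s : 'I_(size h) -> {mpoly R[N]}),
    [/\ sumsq s0, forall j, sumsq (s j) & p = s0 + \sum_j s j * h`_j].
Proof.
split=> [[d [s0 [s [h1 _ h2 _ h3]]]]|[s0 [s [h1 h2 h3]]]]; first by exists s0, s.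
exists (maxn (mpoly.msize s0) (\max_j mpoly.msize (s j * h`_j))), s0, s.
split => //; rewrite /deg_le.
- by rewrite ltnW// ltnS leq_maxl.
- move=> j; rewrite ltnW// ltnS; apply: leq_trans _ (leq_maxr _ _).
  exact: (@leq_bigmax _ (fun j => mpoly.msize (s j * h`_j))).
Qed.

Lemma quadratic_module_of h : quadratic_module (qmodule_of h).
Proof.
have s00 : sumsq (0 : {mpoly R[N]}) by exact: sumsq0.
split=> [|p q /qmodule_ofP[s0 [s [h1 h2 ->]]] /qmodule_ofP[t0 [t [k1 k2 ->]]]|].
- apply/qmodule_ofP; exists 1, (fun=> 0); split => //.
    by rewrite -(expr1n _ 2); exact: sumsqX.
  by rewrite big1 ?addr0// => j _; rewrite mul0r.
- apply/qmodule_ofP; exists (s0 + t0), (fun j => s j + t j); split.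
  + exact: sumsqD.
  + by move=> j; exact: sumsqD.
  + by rewrite addrACA -big_split; congr (_ + _); apply: eq_bigr => j _; rewrite mulrDl.
- move=> a p /qmodule_ofP[s0 [s [h1 h2 ->]]].
  apply/qmodule_ofP; exists (a ^+ 2 * s0), (fun j => a ^+ 2 * s j); split.
  + exact: sumsqXM.
  + by move=> j; exact: sumsqXM.
  + by rewrite mulrDr mulr_sumr; congr (_ + _); apply: eq_bigr => j _; rewrite mulrA.
Qed.

Lemma qmodule_of_mem h p : p \in h -> qmodule_of h p.
Proof.
move=> /(nthP 0)[k kh <-]; apply/qmodule_ofP.
exists 0, (fun j => if j == Ordinal kh then 1 else 0); split.
- exact: sumsq0.
- move=> j; case: ifP => _; last exact: sumsq0.
  by rewrite -(expr1n _ 2); exact: sumsqX.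
- rewrite add0r (bigD1 (Ordinal kh))//= eqxx mul1r big1 ?addr0// => j /negbTE ->.
  by rewrite mul0r.
Qed.

(** Characters are evaluations at points, and one that is nonnegative on the generators [h]
    evaluates at a point of the semialgebraic set. *)
Theorem putinar h p : archimedean (qmodule_of h) ->
  (forall x, basic_semialgebraic h x -> 0 < peval p x) -> qmodule_of h p.
Proof.
move=> arh pos; apply: jacobi => //; first exact: quadratic_module_of.
move=> f /character_peval[x fx] fpos; rewrite fx; apply: pos => q qh.
by rewrite -fx; apply: fpos; exact: qmodule_of_mem.
Qed.

(* A substitute for compactness: the polynomials that are eventually
   nonnegative along u form an archimedean quadratic module, and a character
   nonnegative on it is a cluster point of u. *)
Lemma bounded_cluster (u : nat -> 'cV[R]_N) (c : R) :
  (forall k i, `|u k i 0| <= c) ->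
  exists x, forall p, (\forall k \near \oo, 0 <= peval p (u k)) -> 0 <= peval p x.
Proof.
move=> uc; pose Q := [set p | \forall k \near \oo, 0 <= peval p (u k)].
have qmQ : quadratic_module Q.
  split; first by apply: nearW => k; rewrite peval1.
    move=> p q; rewrite /Q /=; apply: filterS2 => k hp hq.
    by rewrite pevalD addr_ge0.
  move=> a p; rewrite /Q /=; apply: filterS => k hp.
  by rewrite pevalM pevalXn mulr_ge0 ?sqr_ge0.
have arQ : archimedean Q.
  apply: mpoly_archimedean => // i; exists (c ^+ 2); apply: nearW => k.
  rewrite pevalB pevalA pevalXn pevalX subr_ge0 -(real_normK (num_real (u k i 0))).
  by rewrite ler_sqr ?nnegrE// ?(le_trans _ (uc k i)).
have Q_1 : ~ Q (-1).
  move=> [k _ /(_ k (leqnn k))] /=.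
  by rewrite pevalN peval1 oppr_ge0 leNgt ltr01.
have [f /character_peval[x fx] fpos] := character_exists qmQ arQ Q_1.
by exists x => p /fpos; rewrite fx.
Qed.

End putinar.

(** * Invariance of Lebesgue measure on tuples *)

Section tuple_columns.
Context {R : realType} {m : nat}.
Implicit Types (v : 'cV[R]_m) (y : m.-tuple R).

Definition col_tuple v : m.-tuple R := [tuple v i 0 | i < m].

Lemma tnth_col_tuple v i : tnth (col_tuple v) i = v i 0.
Proof. by rewrite tnth_map tnth_ord_tuple. Qed.

Lemma col_tupleK : cancel col_tuple (@tuple_col R m).
Proof. by move=> v; apply/colP => i; rewrite mxE tnth_col_tuple. Qed.

Lemma measurable_col_tuple d (T : measurableType d) (f : T -> 'cV[R]_m) :
  (forall i, measurable_fun setT (fun x => f x i 0)) ->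
  measurable_fun setT (fun x => col_tuple (f x)).
Proof.
move=> mf; apply/measurable_fun_tnthP => i.
by apply: eq_measurable_fun (mf i) => x _ /=; rewrite tnth_col_tuple.
Qed.

Lemma measurable_tuple_col i :
  measurable_fun setT (fun y : m.-tuple R => tuple_col y i 0).
Proof.
apply: eq_measurable_fun (@measurable_tnth _ R m i) => y _.
by rewrite mxE.
Qed.

Lemma measurable_fun_tuple_col d (T : measurableType d) (f : T -> m.-tuple R) i :
  measurable_fun setT f -> measurable_fun setT (fun x => tuple_col (f x) i 0).
Proof. by move=> mf; exact: measurableT_comp (measurable_tuple_col i) mf. Qed.

End tuple_columns.

(** * Translation invariance *)

Section lebesgue_shift.
Context {R : realType}.
Local Open Scope ereal_scope.

(** The translated measure has the same values on half-open intervals, which determine Lebesgue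
    measure. *)
Lemma lebesgue_measure_shift (c : R) (A : set (measurableTypeR R)) :
  measurable A -> lebesgue_measure [set x | A (c + x)%R] = lebesgue_measure A.
Proof.
move=> mA; have mc : @measurable_fun _ _ (measurableTypeR R) (measurableTypeR R) setT
    (fun x => (c + x)%R).
  by apply: measurable_funD => //; exact: measurable_cst.
pose mu : {measure set (measurableTypeR R) -> \bar R} :=
  measure_function_pushforward__canonical__measure_function_Measure
    (@lebesgue_measure R) mc.
apply/esym; rewrite -[RHS]/(mu A).
apply: (@lebesgue_measure_unique R mu _ A mA) => _ [[a b] _ <-] /=.
rewrite /mu /= /pushforward.
rewrite (_ : _ @^-1` _ = `](a - c)%R, (b - c)%R]%classic); last first.
  by apply/seteqP; split => x /=; rewrite !in_itv /= ltrBlDl lerBrDl.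
by rewrite !lebesgue_measure_itv /= !lte_fin ltrD2r -!EFinD opprB addrA subrK.
Qed.

Lemma lebesgue_tuple_consE m (A : set (m.+1.-tuple R)) : measurable A ->
  lebesgue_tuple A =
  \int[lebesgue_measure]_(x in [set: measurableTypeR R])
    lebesgue_tuple [set y | A (Defs.cons_tuple (x, y))].
Proof.
move=> mA; rewrite /= /pushforward /product_measure1; apply: eq_integral => x _.
by congr lebesgue_tuple; apply/seteqP; split => y; rewrite /xsection /= inE.
Qed.

Lemma measurable_lebesgue_tuple_section m (A : set (m.+1.-tuple R)) :
  measurable A ->
  measurable_fun [set: measurableTypeR R]
    (fun x => lebesgue_tuple [set y | A (Defs.cons_tuple (x, y))]).
Proof.
move=> mA.
have mB : measurable (@Defs.cons_tuple R m @^-1` A).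
  by rewrite -[X in measurable X]setTI; exact: measurable_cons_tuple.
apply: eq_measurable_fun (measurable_fun_xsection (@lebesgue_tuple R m) mB) => x _ /=.
by congr lebesgue_tuple; apply/seteqP; split => y; rewrite /xsection /= inE.
Qed.

Lemma measurable_cons_section m (A : set (m.+1.-tuple R)) (x : measurableTypeR R) :
  measurable A -> measurable [set y | A (Defs.cons_tuple (x, y))].
Proof.
move=> mA; have mB : measurable (@Defs.cons_tuple R m @^-1` A).
  by rewrite -[X in measurable X]setTI; exact: measurable_cons_tuple.
have := measurable_xsection x mB.
by congr measurable; apply/seteqP; split => y; rewrite /xsection /= inE.
Qed.

(** Induction on sections: the induction hypothesis translates the last coordinates, a change of
    variable in the outer integral the first one. *)
Lemma lebesgue_tuple_shift m (c : 'cV[R]_m) (A : set (m.-tuple R)) :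
  measurable A ->
  lebesgue_tuple [set y | A (col_tuple (c + tuple_col y)%R)] = lebesgue_tuple A.
Proof.
elim: m => [|m ih] in c A *.
  move=> _; congr lebesgue_tuple; apply/seteqP.
  by split => y /=; rewrite [col_tuple _]tuple0 [y]tuple0.
move=> mA; have ms : measurable_fun setT
    (fun y : m.+1.-tuple R => col_tuple (c + tuple_col y)%R).
  apply: measurable_col_tuple => i.
  apply: (@eq_measurable_fun _ _ _ _ _ (fun y : m.+1.-tuple R => (c i ord0 + tuple_col y i ord0)%R)).
    by move=> y _; rewrite [RHS]mxE.
  by apply: measurable_funD => //; exact: measurable_tuple_col.
rewrite !lebesgue_tuple_consE//; last first.
  by rewrite -[X in measurable X]setTI; exact: ms.
pose G x := lebesgue_tuple [set y | A (Defs.cons_tuple (x, y))].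
have mc : @measurable_fun _ _ (measurableTypeR R) (measurableTypeR R) setT
    (fun x => (c ord0 ord0 + x)%R).
  by apply: measurable_funD => //; exact: measurable_cst.
transitivity (\int[lebesgue_measure]_(x in [set: measurableTypeR R]) G (c ord0 ord0 + x)%R).
  apply: eq_integral => x _.
  rewrite /G -[RHS](ih (\col_i c (lift ord0 i) ord0)); last exact: measurable_cons_section.
  congr lebesgue_tuple; apply/seteqP.
  have E y : col_tuple (c + tuple_col (Defs.cons_tuple (x, y)))%R =
     Defs.cons_tuple ((c ord0 ord0 + x)%R, col_tuple (\col_i c (lift ord0 i) ord0 + tuple_col y)%R).
    apply: eq_from_tnth => i; rewrite tnth_col_tuple !mxE.
    have [j ->|->] := unliftP ord0 i; last by rewrite !tnth0.
    by rewrite !tnthS tnth_col_tuple !mxE.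
  by split => y; rewrite /= E.
pose mu : {measure set (measurableTypeR R) -> \bar R} :=
  measure_function_pushforward__canonical__measure_function_Measure
    (@lebesgue_measure R) mc.
transitivity (\int[mu]_(x in [set: measurableTypeR R]) G x); last first.
  apply: eq_measure_integral => B mB _.
  exact: lebesgue_measure_shift.
apply/esym; have := @ge0_integral_pushforward _ _ (measurableTypeR R) (measurableTypeR R) R
  _ mc lebesgue_measure setT G measurableT (measurable_lebesgue_tuple_section mA)
  (fun _ _ => measure_ge0 _ _).
by rewrite preimage_setT.
Qed.

End lebesgue_shift.

(** * Cubes, and invariance under linear maps *)

Section lebesgue_linear.
Context {R : realType}.
Local Open Scope ereal_scope.

(** Cubes have an explicit volume under the iterated product; comparison with them shows that balls
    have positive finite measure. *)
Definition cube m (a : R) : set (m.-tuple R) :=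
  [set y | forall i, (`|tuple_col y i ord0| <= a)%R].

Lemma measurable_cube m a : measurable (@cube m a).
Proof.
rewrite (_ : cube a = \bigcap_(i in [set: 'I_m])
    ((fun y : m.-tuple R => tuple_col y i ord0) @^-1` `[(- a)%R, a]%classic)).
  apply: fin_bigcap_measurable => // i _.
  by rewrite -[X in measurable X]setTI; apply: measurable_tuple_col.
apply/seteqP; split => y /= h i; first by move=> _; rewrite /preimage /= in_itv /= -ler_norml.
by have := h i Logic.I; rewrite /= in_itv /= -ler_norml.
Qed.

Lemma lebesgue_tuple_cube m (a : R) : (0 <= a)%R ->
  lebesgue_tuple (@cube m a) = ((a + a) ^+ m)%:E.
Proof.
move=> a0; elim: m => [|m ih].
  by rewrite expr0 /= diracE mem_set// => -[].
rewrite lebesgue_tuple_consE; last exact: measurable_cube.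
transitivity (\int[lebesgue_measure]_(x in [set: measurableTypeR R])
    ((\1_(`[(- a)%R, a]%classic) x)%:E * ((a + a) ^+ m)%:E)).
  apply: eq_integral => x _.
  have E y : cube a (Defs.cons_tuple (x, y)) <-> (`|x| <= a)%R /\ cube a y.
    split=> [h|[h1 h2] i].
      split=> [|i]; first by have := h ord0; rewrite mxE tnth0.
      by have := h (lift ord0 i); rewrite !mxE tnthS.
    have [j ->|->] := unliftP ord0 i; last by rewrite mxE tnth0.
    by have := h2 j; rewrite !mxE tnthS.
  have [xa|xa] := boolP (x \in `[(- a)%R, a]%classic).
    rewrite indicE xa mul1e -ih; congr lebesgue_tuple.
    move: xa; rewrite inE /= in_itv /= -ler_norml => xa.
    by apply/predeqP => y /=; rewrite E; split => [[]|].
  rewrite indicE (negbTE xa) mul0e (_ : [set y | _] = set0) ?measure0//.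
  apply/seteqP; split => y //=; rewrite E => -[h _].
  by move: xa; rewrite notin_setE /= in_itv /= -ler_norml => /(_ h).
rewrite ge0_integralZr//; [|by apply/measurable_EFinP; exact: measurable_indic
  |by rewrite lee_fin exprn_ge0// addr_ge0].
rewrite integral_indic// setIT [X in X * _](@lebesgue_measure_itv R `[(- a)%R, a]) /= lte_fin.
rewrite exprS EFinM; congr (_ * _).
have [a_gt|] := ltP (- a)%R a; first by rewrite -EFinD opprK.
by move=> h; congr EFin; apply/eqP; rewrite eq_le addr_ge0//=; lra.
Qed.

Section invariance.
Variables (m : nat) (Q : 'M[R]_m) (B : set (m.-tuple R)).
Hypothesis QU : Q \in unitmx.
Hypotheses (mB : measurable B) (B0 : 0 < lebesgue_tuple B)
  (Boo : lebesgue_tuple B < +oo).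
Hypothesis QB : forall y, B (col_tuple (- (Q *m tuple_col y))%R) <-> B y.

Local Notation mu := (@lebesgue_tuple R m).
Local Notation phi := (fun y : m.-tuple R => Q *m tuple_col y).

Let measurable_phi i : measurable_fun setT (fun y => phi y i ord0).
Proof.
apply: (@eq_measurable_fun _ _ _ _ _
    (fun y : m.-tuple R => (\sum_j Q i j * tuple_col y j ord0)%R)).
  by move=> y _; rewrite [RHS]mxE.
apply: measurable_sum => j; apply: measurable_funM; first exact: measurable_cst.
exact: measurable_tuple_col.
Qed.

(** Tonelli's theorem for the indicator of [E], stated through sections. *)
Let swap (E : set (m.-tuple R * m.-tuple R)) : measurable E ->
  \int[mu]_x mu [set y | E (x, y)] = \int[mu]_y mu [set x | E (x, y)].
Proof.
move=> mE; transitivity (\int[mu]_x fubini_F mu (EFin \o \1_E) x).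
  apply: eq_integral => x _; rewrite (indic_fubini_tonelli_FE mu)//=.
  by congr lebesgue_tuple; apply/seteqP; split => y; rewrite /xsection /= inE.
rewrite (indic_fubini_tonelli mu mu)//; apply: eq_integral => y _.
rewrite (indic_fubini_tonelli_GE mu)//=.
by congr lebesgue_tuple; apply/seteqP; split => x; rewrite /ysection /= inE.
Qed.

Let measurable_preimage_col d (T : measurableType d) (f : T -> 'cV[R]_m) A :
  measurable A -> (forall i, measurable_fun setT (fun x => f x i ord0)) ->
  measurable [set x | A (col_tuple (f x))].
Proof.
move=> mA mf; rewrite -[X in measurable X]setTI.
exact: (measurable_col_tuple mf).
Qed.

Let int_indic (C : set (m.-tuple R)) (c : \bar R) : measurable C -> 0 <= c ->
  \int[mu]_y (c * (\1_C y)%:E) = c * mu C.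
Proof.
move=> mC c0; rewrite ge0_integralZl//.
- by rewrite integral_indic// setIT.
- by apply/measurable_EFinP; exact: measurable_indic.
Qed.

(* Uniqueness of Haar measure: both sides times mu B are the measure of
   {(x, y) | A (Q y), B (x - Q y)}, computed by sections after translating x
   by Q y, resp. y by Q^-1 x. *)
Lemma lebesgue_tuple_linear A : measurable A ->
  mu [set y | A (col_tuple (phi y))] = mu A.
Proof.
move=> mA; set A' := [set y | A (col_tuple (phi y))].
have mA' : measurable A' by exact: measurable_preimage_col.
have fst_m i : measurable_fun setT
    (fun p : m.-tuple R * m.-tuple R => tuple_col p.1 i ord0).
  exact: measurable_fun_tuple_col measurable_fst.
have snd_m i : measurable_fun setT
    (fun p : m.-tuple R * m.-tuple R => phi p.2 i ord0).
  exact: measurableT_comp (measurable_phi i) measurable_snd.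
pose E := [set p : m.-tuple R * m.-tuple R |
  A' p.2 /\ B (col_tuple (tuple_col p.1 - phi p.2)%R)].
have mE : measurable E.
  apply: measurableI.
    by rewrite -[X in measurable X]setTI; apply: measurable_snd.
  apply: measurable_preimage_col => // i.
  apply: (eq_measurable_fun (fun p : m.-tuple R * m.-tuple R =>
     (tuple_col p.1 i ord0 - phi p.2 i ord0)%R)).
    by move=> p _; rewrite [RHS]mxE; congr (_ + _)%R; rewrite [RHS]mxE.
  exact: measurable_funB.
pose F := [set p : m.-tuple R * m.-tuple R |
  A (col_tuple (phi p.2 + tuple_col p.1)%R) /\ B p.2].
have mF : measurable F.
  apply: measurableI; last first.
    by rewrite -[X in measurable X]setTI; apply: measurable_snd.
  apply: measurable_preimage_col => // i.
  apply: (eq_measurable_fun (fun p : m.-tuple R * m.-tuple R =>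
     (phi p.2 i ord0 + tuple_col p.1 i ord0)%R)).
    by move=> p _; rewrite [RHS]mxE.
  exact: measurable_funD.
have muB : mu B \is a fin_num by rewrite ge0_fin_numE.
(* [mu B] is positive and finite, so it can be cancelled. *)
suff : mu A' * mu B = mu A * mu B.
  by move=> /(congr1 (fun x => x * (fine (mu B))^-1%:E)); rewrite -!muleA
    -(fineK muB) -EFinM divff ?mule1// gt_eqF// fine_gt0// B0 ltey_eq muB.
transitivity (\int[mu]_y mu [set x | E (x, y)]).
  rewrite muleC -int_indic//; apply: eq_integral => y _.
  have [yA|yA] := boolP (y \in A').
    rewrite indicE yA mule1; rewrite inE in yA.
    rewrite -[LHS](lebesgue_tuple_shift (- phi y)%R)//.
    congr lebesgue_tuple; apply/predeqP => x.
    by rewrite /E /= (addrC (tuple_col x)); split => [h|[]].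
  rewrite indicE (negbTE yA) mule0 (_ : [set _ | _] = set0) ?measure0//.
  by apply/seteqP; split => x //= [/mem_set]; rewrite (negbTE yA).
rewrite -(swap mE).
transitivity (\int[mu]_x mu [set y | F (x, y)]).
  apply: eq_integral => x _.
  have mEx : measurable [set y | E (x, y)].
    have := measurable_xsection x mE.
    by congr measurable; apply/seteqP; split => y; rewrite /xsection /= inE.
  (* Substituting $y+Q^{-1}x$ for $y$ turns $x-Qy$ into $-Qy$, whence the minus sign in [QB]. *)
  rewrite -[LHS](lebesgue_tuple_shift (invmx Q *m tuple_col x))//.
  congr lebesgue_tuple; apply/seteqP; rewrite /E /F /A'.
  have H y : Q *m tuple_col (col_tuple (invmx Q *m tuple_col x + tuple_col y)%R) =
    (phi y + tuple_col x)%R.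
    by rewrite col_tupleK mulmxDr mulmxA mulmxV// mul1mx addrC.
  have K y : (tuple_col x - (phi y + tuple_col x))%R = (- phi y)%R.
    by rewrite opprD addrCA subrr addr0.
  by split => y /=; rewrite H K QB.
rewrite (swap mF) -int_indic//; apply: eq_integral => y _.
have [yB|yB] := boolP (y \in B).
  rewrite indicE yB mule1; rewrite inE in yB.
  rewrite -[RHS](lebesgue_tuple_shift (phi y))//.
  by congr lebesgue_tuple; apply/seteqP; split => x /= => [[]|].
rewrite indicE (negbTE yB) mule0 (_ : [set _ | _] = set0) ?measure0//.
by apply/seteqP; split => x //= [_ /mem_set]; rewrite (negbTE yB).
Qed.

End invariance.

End lebesgue_linear.

(** * Measure of balls, orthogonal invariance, integrals of polynomials over fibres *)

Section polynomials_on_balls.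
Context {R : realType}.

Lemma measurable_peval N (p : {mpoly R[N]}) d (T : measurableType d)
    (f : T -> 'cV[R]_N) :
  (forall i, measurable_fun setT (fun x => f x i 0)) ->
  measurable_fun setT (fun x => peval p (f x)).
Proof.
move=> mf; rewrite /peval; under eq_fun do rewrite mevalE.
apply: measurable_sum => mm; apply: measurable_funM; first exact: measurable_cst.
by apply: measurable_prod => i _; exact: measurable_funX.
Qed.

Lemma peval_bounded N (p : {mpoly R[N]}) (c : R) :
  exists b : R, forall x : 'cV[R]_N, (forall i, `|x i 0| <= c) -> `|peval p x| <= b.
Proof.
exists (\sum_(mm <- mpoly.msupp p) `|mpoly.mcoeff mm p| * \prod_i `|c| ^+ mm i).
move=> x xc; rewrite /peval mevalE (le_trans (ler_norm_sum _ _ _))//.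
apply: ler_sum => mm _; rewrite normrM ler_wpM2l// normr_prod.
apply: ler_prod => i _; rewrite normr_ge0 normrX lerXn2r// ?nnegrE//.
exact: le_trans (xc i) (ler_norm c).
Qed.

Lemma norm2_ge0 k (y : 'cV[R]_k) : 0 <= norm2 y.
Proof. exact: sqrtr_ge0. Qed.

Lemma sqr_norm2 k (y : 'cV[R]_k) : norm2 y ^+ 2 = \sum_i y i 0 ^+ 2.
Proof. by rewrite sqr_sqrtr// sumr_ge0// => i _; exact: sqr_ge0. Qed.

Lemma norm2_le k (y : 'cV[R]_k) (c : R) : 0 <= c ->
  (norm2 y <= c) = (\sum_i y i 0 ^+ 2 <= c ^+ 2).
Proof. by move=> c0; rewrite -sqr_norm2 ler_sqr// nnegrE// norm2_ge0. Qed.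

Lemma ler_coord_norm2 k (y : 'cV[R]_k) i : `|y i 0| <= norm2 y.
Proof.
rewrite -[leLHS]ger0_norm// -ler_sqr ?nnegrE ?norm2_ge0// real_normK ?num_real//.
rewrite real_normK ?num_real// sqr_norm2 (bigD1 i)//= lerDl.
by apply: sumr_ge0 => j _; exact: sqr_ge0.
Qed.

Lemma sub_ball_cube k (c : R) : @tuple_ball R k c `<=` cube c.
Proof. by move=> y yc i; exact: le_trans (ler_coord_norm2 _ _) yc. Qed.

(** $k\,(c/(k+1))^2\le c^2$; the denominator $k+1$ avoids a square root and is nonzero also for
    $k=0$. *)
Lemma sub_cube_ball k (c : R) : 0 <= c ->
  cube (c / k.+1%:R) `<=` @tuple_ball R k c.
Proof.
move=> c0 y yc; rewrite /tuple_ball /= norm2_le//.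
have le1 i : tuple_col y i 0 ^+ 2 <= (c / k.+1%:R) ^+ 2.
  rewrite -(real_normK (num_real (tuple_col y i 0))) ler_sqr ?nnegrE//.
  by rewrite divr_ge0.
apply: le_trans (ler_sum _ (fun i _ => le1 i)) _.
rewrite sumr_const card_ord -[leLHS]mulr_natl.
rewrite expr_div_n mulrA mulrAC.
rewrite ler_piMl ?sqr_ge0// ler_pdivrMr ?exprn_gt0// mul1r -natrX ler_nat.
by rewrite (leq_trans (leqnSn k))// expnS expn1 leq_pmulr.
Qed.

Lemma measurable_tuple_ball k (c : R) : measurable (@tuple_ball R k c).
Proof.
rewrite -[X in measurable X]setTI.
(* A negative radius gives the empty ball although its square is positive, hence the conjunct
   [0 <= c]. *)
rewrite (_ : @tuple_ball R k c =
  (fun y : k.-tuple R => \sum_i tuple_col y i 0 ^+ 2) @^-1` [set z | 0 <= c /\ z <= c ^+ 2]).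
  apply: measurable_sum => //; first by move=> i; apply: measurable_funX; exact: measurable_tuple_col.
  have [c0|c0] := leP 0 c.
    rewrite (_ : [set z | _] = `]-oo, c ^+ 2]%classic); first exact: measurable_itv.
    by apply/seteqP; split => z /=; rewrite in_itv//= => -[].
  rewrite (_ : [set z | _] = set0); first exact: measurable0.
  by apply/seteqP; split => z //= [].
apply/predeqP => y; rewrite /tuple_ball /preimage /=; split.
  move=> h; have c0 : 0 <= c by apply: le_trans h; exact: norm2_ge0.
  by rewrite -norm2_le.
by case=> c0; rewrite norm2_le.
Qed.

Lemma lebesgue_ball_ltoo k (c : R) : 0 <= c ->
  (lebesgue_tuple (@tuple_ball R k c) < +oo)%E.
Proof.
move=> c0; apply: (@le_lt_trans _ _ (lebesgue_tuple (@cube R k c))).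
  apply: le_measure; rewrite ?inE; [exact: measurable_tuple_ball|exact: measurable_cube|].
  exact: sub_ball_cube.
by rewrite lebesgue_tuple_cube// ltry.
Qed.

Lemma lebesgue_ball_gt0 k (c : R) : 0 < c ->
  (0 < lebesgue_tuple (@tuple_ball R k c))%E.
Proof.
move=> c0; apply: (@lt_le_trans _ _ (lebesgue_tuple (@cube R k (c / k.+1%:R)))).
  by rewrite lebesgue_tuple_cube ?divr_ge0 ?ltW// lte_fin exprn_gt0// addr_gt0 ?divr_gt0.
apply: le_measure; rewrite ?inE; [exact: measurable_cube|exact: measurable_tuple_ball|].
exact/sub_cube_ball/ltW.
Qed.

(** The unit ball serves as the reference set: it is preserved by $-Q$ because $Q$ is an
    isometry. *)
Lemma lebesgue_tuple_orthogonal m (Q : 'M[R]_m) (A : set (m.-tuple R)) :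
  Q^T *m Q = 1%:M -> measurable A ->
  lebesgue_tuple [set y | A (col_tuple (Q *m tuple_col y))] = lebesgue_tuple A.
Proof.
move=> QQ mA; have QU : Q \in unitmx by have [_] := mulmx1_unit QQ.
apply: (@lebesgue_tuple_linear R m Q (tuple_ball 1)) => //.
- exact: measurable_tuple_ball.
- exact: lebesgue_ball_gt0.
- exact: lebesgue_ball_ltoo.
move=> y; rewrite /tuple_ball /= col_tupleK !norm2_le//.
rewrite (_ : \sum_i _ = \sum_i tuple_col y i 0 ^+ 2)//.
have sqE k (x : 'cV[R]_k) : \sum_i x i 0 ^+ 2 = (x^T *m x) 0 0.
  by rewrite mxE; apply: eq_bigr => i _; rewrite mxE.
rewrite (eq_bigr (fun i => (Q *m tuple_col y) i 0 ^+ 2)); last first.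
  by move=> i _; rewrite mxE sqrrN.
by rewrite !sqE trmx_mul -mulmxA (mulmxA Q^T) QQ mul1mx.
Qed.

Lemma measurable_basic_semialgebraic N (g : seq {mpoly R[N]}) d
    (T : measurableType d) (f : T -> 'cV[R]_N) :
  (forall i, measurable_fun setT (fun x => f x i 0)) ->
  measurable [set x | basic_semialgebraic g (f x)].
Proof.
move=> mf; rewrite (_ : [set x | _] = \bigcap_(p in [set` g])
    ((fun x => peval p (f x)) @^-1` `[0, +oo[%classic)).
  apply: fin_bigcap_measurable => // p _.
  by rewrite -[X in measurable X]setTI; apply: measurable_peval.
apply/predeqP => x; split=> h p pg; last by have := h p pg; rewrite /= in_itv /= andbT.
by rewrite /preimage /= in_itv /= andbT; exact: h.
Qed.

(** * The operator $\Lambda_R$ on polynomials *)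

Section fiber.
Variables (m : nat) (r : R).
Hypothesis r0 : 0 <= r.
Local Notation mu := (@lebesgue_tuple R m).
Local Notation B := (@tuple_ball R m r).
Implicit Types (w : {mpoly R[psi_dim m]}) (u : 'cV[R]_(omega_dim m)).

Lemma measurable_fiber u i :
  measurable_fun setT (fun y : m.-tuple R => (col_mx u (tuple_col y) : 'cV[R]_(psi_dim m)) i 0).
Proof.
rewrite -[i](@splitK (omega_dim m) m); case: (@fintype.split (omega_dim m) m i) => j.
  apply: (@eq_measurable_fun _ _ _ _ _ (cst (u j 0))) => // y _.
  by rewrite /= [RHS](col_mxEu u).
apply: (@eq_measurable_fun _ _ _ _ _ (fun y : m.-tuple R => tuple_col y j 0)) => [y _|].
  by rewrite /= [RHS](col_mxEd u).
exact: measurable_tuple_col.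
Qed.

Lemma integrable_fiber w u :
  mu.-integrable B (EFin \o (fun y => peval w (col_mx u (tuple_col y)))).
Proof.
apply: measurable_bounded_integrable.
- exact: measurable_tuple_ball.
- exact: lebesgue_ball_ltoo.
- by apply: measurable_funTS; apply: measurable_peval => i; exact: measurable_fiber.
have [b hb] := peval_bounded w (norm2 u + r).
exists b; split; first exact: num_real.
move=> c bc y yB; apply/ltW/(le_lt_trans _ bc)/hb => i.
rewrite -[i](@splitK (omega_dim m) m); case: (@fintype.split (omega_dim m) m i) => j.
  by rewrite /= (col_mxEu u) (le_trans (ler_coord_norm2 _ _))// lerDl.
rewrite /= (col_mxEd u) (le_trans (ler_coord_norm2 _ _))// (le_trans yB)//.
by rewrite lerDr norm2_ge0.
Qed.

Lemma LambdaE w u : (Lambda r w u)%:E =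
  (\int[mu]_(y in B) (peval w (col_mx u (tuple_col y)))%:E)%E.
Proof.
rewrite /Lambda /Rintegral fineK//.
by apply: integrable_fin_num; [exact: measurable_tuple_ball|exact: integrable_fiber].
Qed.

Lemma LambdaD w w' u : Lambda r (w + w') u = Lambda r w u + Lambda r w' u.
Proof.
rewrite /Lambda -RintegralD; [|exact: measurable_tuple_ball|exact: integrable_fiber..].
by apply: eq_Rintegral => y _; rewrite pevalD.
Qed.

Lemma LambdaZ c w u : Lambda r (c *: w) u = c * Lambda r w u.
Proof.
rewrite /Lambda -RintegralZl; [|exact: measurable_tuple_ball|exact: integrable_fiber].
by apply: eq_Rintegral => y _; rewrite pevalZ.
Qed.

Lemma Lambda_le w w' u :
  (forall y, B y -> peval w (col_mx u (tuple_col y)) <=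
                    peval w' (col_mx u (tuple_col y))) ->
  Lambda r w u <= Lambda r w' u.
Proof.
by move=> h; apply: le_Rintegral => //; [exact: measurable_tuple_ball|exact: integrable_fiber..].
Qed.

(** Each monomial is a product of a monomial in $u$, which leaves the integral, and one in $y$,
    which integrates to a constant. *)
Lemma Lambda_mpoly w : exists q, forall u, peval q u = Lambda r w u.
Proof.
elim/mpolyind: w => [|c mm w _ _ [q hq]].
  exists 0 => u; rewrite peval0 /Lambda.
  under eq_Rintegral do rewrite peval0.
  by rewrite Rintegral_cst ?mul0r//; exact: measurable_tuple_ball.
pose wy : {mpoly R[psi_dim m]} := \prod_(j < m)
  (mpolyX R (mnm1 (rshift (omega_dim m) j)) ^+ mm (rshift (omega_dim m) j)).
exists (c *: (Lambda r wy 0 *: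
    \prod_(i < omega_dim m) (mpolyX R (mnm1 i) ^+ mm (lshift m i))) + q) => u.
rewrite pevalD hq LambdaD LambdaZ pevalZ; congr (_ * _ + _).
have wyE v y : peval wy (col_mx v (tuple_col y)) =
    \prod_(j < m) tuple_col y j 0 ^+ mm (rshift (omega_dim m) j).
  rewrite /peval rmorph_prod; apply: eq_bigr => j _.
  by rewrite rmorphXn /= mevalXU (col_mxEd v).
(* [wy] involves only the $y$ variables, so its integral may be taken over any base point; [0] was
   the arbitrary choice. *)
have ->: Lambda r wy 0 = Lambda r wy u.
  by apply: eq_Rintegral => y _; rewrite !wyE.
rewrite pevalZ mulrC /Lambda -RintegralZl; [|exact: measurable_tuple_ball|exact: integrable_fiber].
apply: eq_Rintegral => y _; rewrite wyE {2}/peval mevalX (@big_split_ord _ _ _ (omega_dim m) m).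
congr (_ * _); last by apply: eq_bigr => j _; rewrite (col_mxEd u).
rewrite /peval rmorph_prod; apply: eq_bigr => j _.
by rewrite rmorphXn /= mevalXU (col_mxEu u).
Qed.

End fiber.

End polynomials_on_balls.

(** * Orthonormal frames and slices *)

Section frames.
Context {R : realType} {m : nat}.
Implicit Types (theta x : 'cV[R]_m.+1) (Z : 'M[R]_(m.+1, m)).

Lemma dotpE theta x : theta^T *m x = (dotp theta x)%:M.
Proof.
rewrite [LHS]mx11_scalar mxE; congr (_%:M).
by apply: eq_bigr => i _; rewrite mxE.
Qed.

Lemma norm2_dotp k (x : 'cV[R]_k) : norm2 x ^+ 2 = dotp x x.
Proof. by rewrite sqr_norm2; apply: eq_bigr => i _; rewrite expr2. Qed.

Lemma orthogonal_frameP theta Z : orthogonal_group (frame_mx theta Z) <->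
  [/\ dotp theta theta = 1, theta^T *m Z = 0 & Z^T *m Z = 1%:M].
Proof.
rewrite /orthogonal_group /frame_mx /=.
have E : (row_mx theta Z)^T *m row_mx theta Z = block_mx (theta^T *m theta)
    (theta^T *m Z) (Z^T *m theta) (Z^T *m Z).
  by rewrite tr_row_mx mul_col_row.
have I1 : 1%:M = block_mx 1%:M 0 0 1%:M :> 'M[R]_(1 + m) by exact: scalar_mx_block.
split=> [|[h1 h2 h3]].
  rewrite E => h; have [h1 h2 _ h4] := @eq_block_mx _ 1 m 1 m _ _ _ _ _ _ _ _ (etrans h I1).
  split => //.
  by move: h1; rewrite dotpE => /matrixP/(_ 0 0); rewrite !mxE eqxx !mulr1n.
have h2' : Z^T *m theta = 0 by rewrite -[LHS]trmxK trmx_mul trmxK h2 trmx0.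
by rewrite E dotpE h1 h2 h2' h3 -I1.
Qed.

(* Householder reflection exchanging theta and the first basis vector. *)
Lemma orthogonal_frame_exists theta : norm2 theta = 1 ->
  exists Z, orthogonal_group (frame_mx theta Z).
Proof.
move=> theta1; have tt : dotp theta theta = 1 by rewrite -norm2_dotp theta1 expr1n.
(* Any orthogonal matrix with first column [theta] will do: its other columns form [Z]. *)
suff [H [HH Ht]] : exists H : 'M[R]_(m.+1, 1 + m), H^T *m H = 1%:M /\ lsubmx H = theta.
  exists (rsubmx H); rewrite /orthogonal_group /frame_mx /= -Ht.
  by rewrite (@hsubmxK _ _ 1 m).
pose e : 'cV[R]_m.+1 := delta_mx 0 0.
have lsubE (A : 'M[R]_(m.+1, 1 + m)) : lsubmx A = A *m e.
  apply/colP => i; rewrite !mxE (bigD1 0)//= !mxE eqxx mulr1 big1 ?addr0 => [|j j0].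
    by congr (A i _); exact: val_inj.
  by rewrite !mxE (negbTE j0) mulr0.
have ee : dotp e e = 1.
  rewrite /dotp (bigD1 0)//= !mxE eqxx mulr1 big1 ?addr0// => i i0.
  by rewrite !mxE (negbTE i0) mulr0.
(* When [theta] equals [e] the reflection vector [v] vanishes, and the identity matrix is used
   instead. *)
have [te|te] := eqVneq theta e.
  by exists 1%:M; rewrite lsubE trmx1 !mul1mx te.
pose v := theta - e; pose s := dotp v v.
have s0 : s != 0.
  rewrite /s -norm2_dotp sqr_norm2 psumr_neq0; last by move=> i _; exact: sqr_ge0.
  have : v != 0 by rewrite subr_eq0.
  apply: contraNT => /hasPn h; apply/eqP/colP => i; rewrite [RHS]mxE.
  by have := h i (mem_index_enum i); rewrite /= lt0r sqr_ge0 andbT negbK sqrf_eq0 => /eqP.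
have dotC : dotp e theta = dotp theta e.
  by apply: eq_bigr => i _; rewrite mulrC.
have dotDl (a b c : 'cV[R]_m.+1) : dotp (a - b) c = dotp a c - dotp b c.
  by rewrite /dotp -sumrB; apply: eq_bigr => i _; rewrite !mxE mulrBl.
have dotDr (a b c : 'cV[R]_m.+1) : dotp c (a - b) = dotp c a - dotp c b.
  by rewrite /dotp -sumrB; apply: eq_bigr => i _; rewrite !mxE mulrBr.
have sE : s = 2 * (1 - dotp theta e).
  by rewrite /s /v !dotDl !dotDr tt ee dotC; ring.
(* Both vectors are unit, so $\|v\|^2=2(1-\theta\cdot e)=-2\,v\cdot e$; hence the reflection sends
   $e$ to $e+v=\theta$. *)
have ve : dotp v e = - (s / 2) by rewrite sE /v dotDl ee; field.
pose H : 'M[R]_m.+1 := 1%:M - (2 / s) *: (v *m v^T).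
have HT : H^T = H by rewrite /H linearB linearZ /= trmx1 trmx_mul trmxK.
exists H; split.
  rewrite HT /H mulmxBl mul1mx mulmxBr mulmx1 -scalemxAl -scalemxAr -mulmxA.
  rewrite (mulmxA v^T) dotpE -/s mul_scalar_mx -scalemxAr !scalerA.
  by rewrite divfK// mulr_natr mulr2n scalerDl opprB addrK subrK.
rewrite lsubE /H mulmxBl mul1mx -scalemxAl -mulmxA dotpE ve mul_mx_scalar scalerA.
rewrite (_ : 2 / s * - (s / 2) = -1); last by field.
by rewrite scaleN1r opprK /v addrC subrK.
Qed.

Lemma hyperplane_frameP theta : norm2 theta = 1 ->
  orthogonal_group (frame_mx theta (hyperplane_frame theta)).
Proof.
move=> /orthogonal_frame_exists h.
exact: (@xgetPex _ 0 [set Z | orthogonal_group (frame_mx theta Z)]).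
Qed.

(** Take $Q=Z^TZ'$: the matrix $ZZ^T=I-\theta\theta^T$ is the projection onto the complement of
    $\theta$, so it fixes the columns of $Z'$. *)
Lemma frame_change theta Z Z' : orthogonal_group (frame_mx theta Z) ->
  orthogonal_group (frame_mx theta Z') ->
  exists2 Q : 'M[R]_m, Q^T *m Q = 1%:M & Z' = Z *m Q.
Proof.
move=> h /orthogonal_frameP[_ tZ' ZZ'].
have ZZT : Z *m Z^T = 1%:M - theta *m theta^T.
  have : row_mx theta Z *m (row_mx theta Z)^T = 1%:M := mulmx1C h.
  rewrite tr_row_mx mul_row_col => <-.
  by rewrite addrAC subrr add0r.
exists (Z^T *m Z').
  rewrite trmx_mul trmxK -mulmxA (mulmxA Z) ZZT mulmxBl mul1mx -mulmxA tZ'.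
  by rewrite mulmx0 subr0.
by rewrite mulmxA ZZT mulmxBl mul1mx -mulmxA tZ' mulmx0 subr0.
Qed.

Lemma dotp_frame theta t Z y : orthogonal_group (frame_mx theta Z) ->
  dotp theta (t *: theta + Z *m y) = t.
Proof.
move=> /orthogonal_frameP[h1 h2 _].
have : (dotp theta (t *: theta + Z *m y))%:M = t%:M :> 'M[R]_1.
  rewrite -dotpE mulmxDr mulmxA h2 mul0mx addr0 -scalemxAr dotpE h1.
  by rewrite scalemx1.
by move=> /matrixP/(_ 0 0); rewrite !mxE eqxx !mulr1n.
Qed.

(** Pythagoras, as $\theta$ and the columns of $Z$ are orthonormal. *)
Lemma sqr_norm2_frame theta t Z y : orthogonal_group (frame_mx theta Z) ->
  norm2 (t *: theta + Z *m y) ^+ 2 = t ^+ 2 + norm2 y ^+ 2.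
Proof.
move=> h; have /orthogonal_frameP[h1 h2 h3] := h.
have h2' : Z^T *m theta = 0 by rewrite -[LHS]trmxK trmx_mul trmxK h2 trmx0.
have yE : y^T *m y = (norm2 y ^+ 2)%:M.
  rewrite norm2_dotp [LHS]mx11_scalar mxE; congr (_%:M).
  by apply: eq_bigr => i _; rewrite mxE.
have : (norm2 (t *: theta + Z *m y) ^+ 2)%:M = (t ^+ 2 + norm2 y ^+ 2)%:M :> 'M[R]_1.
  have trE : (t *: theta + Z *m y)^T = t *: theta^T + y^T *m Z^T.
    by rewrite linearD /= linearZ /= trmx_mul.
  rewrite norm2_dotp -dotpE trE mulmxDl !mulmxDr -!scalemxAl -!scalemxAr !mulmxA.
  rewrite h2 mul0mx scaler0 addr0 -(mulmxA y^T _ theta) h2' mulmx0 scaler0 add0r.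
  by rewrite -(mulmxA y^T) h3 mulmx1 yE dotpE h1 !scalemx1 scale_scalar_mx -expr2 -raddfD.
by move=> /matrixP/(_ 0 0); rewrite !mxE eqxx !mulr1n.
Qed.

Definition omega_point theta (t : R) Z : 'cV[R]_(omega_dim m) :=
  col_mx (col_mx theta t%:M) (mxvec Z)^T.

Lemma omega_pointE theta t Z :
  [/\ omega_theta (omega_point theta t Z) = theta,
      omega_t (omega_point theta t Z) = t
    & omega_Z (omega_point theta t Z) = Z].
Proof.
rewrite /omega_theta /omega_t /omega_Z /omega_point; split.
- by rewrite !col_mxKu.
- by rewrite col_mxKu col_mxKd mxE eqxx mulr1n.
- by rewrite col_mxKd trmxK mxvecK.
Qed.

End frames.

(** * Slices of $L$ and the supremum $P^*$ *)

Section sections.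
Context {R : realType}.
Variables (m : nat) (r : R) (g : seq {mpoly R[m.+1]}).
Hypotheses (r_gt0 : 0 < r) (ball_g : ball_poly m.+1 r \in g).
Implicit Types (u : 'cV[R]_(omega_dim m)).

Lemma psi_x_col_mx u (y : 'cV[R]_m) :
  psi_x (col_mx u y : 'cV[R]_(psi_dim m)) = omega_t u *: omega_theta u + omega_Z u *m y.
Proof. by rewrite /psi_x /psi_omega /psi_y col_mxKu col_mxKd. Qed.

Definition slice u : set (m.-tuple R) :=
  [set y | basic_semialgebraic g (omega_t u *: omega_theta u + omega_Z u *m tuple_col y)].

Lemma peval_ball_poly N (x : 'cV[R]_N) : peval (ball_poly N r) x = r ^+ 2 - norm2 x ^+ 2.
Proof.
rewrite /ball_poly pevalB peval_sum sqr_norm2; congr (_ - _); first exact: mevalC.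
by apply: eq_bigr => i _; rewrite pevalXn mxE pevalX.
Qed.

(** $\|y\|^2\le t^2+\|y\|^2=\|\theta t+Zy\|^2\le r^2$. Hence integrating over the ball loses nothing
    of the slice. *)
Lemma slice_ball u : Omega_Z r u -> slice u `<=` tuple_ball r.
Proof.
move=> [_ uO] y /(_ _ ball_g); rewrite peval_ball_poly subr_ge0 sqr_norm2_frame//.
move=> h; rewrite /tuple_ball /= norm2_le -?sqr_norm2; last exact: ltW.
by apply: le_trans h; rewrite lerDr sqr_ge0.
Qed.

Lemma measurable_slice u : measurable (slice u).
Proof.
apply: measurable_basic_semialgebraic => i.
apply: (@eq_measurable_fun _ _ _ _ _ (fun y : m.-tuple R =>
    (omega_t u *: omega_theta u) i 0 + \sum_j omega_Z u i j * tuple_col y j 0)).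
  by move=> y _; rewrite [RHS]mxE; congr (_ + _); rewrite [RHS]mxE.
apply: measurable_funD; first exact: measurable_cst.
apply: measurable_sum => j; apply: measurable_funM; first exact: measurable_cst.
exact: measurable_tuple_col.
Qed.

(** The chosen frame and the frame in [u] differ by an orthogonal matrix, which preserves the
    measure; the equation $\theta\cdot x=t$ holds at every point of the parametrization. *)
Lemma hyperplane_volumeE u : Omega_Z r u ->
  hyperplane_volume (omega_theta u) (omega_t u)
    (basic_semialgebraic g `&` [set x | dotp (omega_theta u) x = omega_t u]) =
  lebesgue_tuple (slice u).
Proof.
move=> [_ uO]; have /orthogonal_frameP[h1 _ _] := uO.
have t1 : norm2 (omega_theta u) = 1.
  by apply/eqP; rewrite -(@eqrXn2 _ 2) ?norm2_ge0// norm2_dotp h1 expr1n.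
have hO := hyperplane_frameP t1.
have [Q QQ ZQ] := frame_change uO hO.
rewrite -(lebesgue_tuple_orthogonal QQ (measurable_slice u)) /hyperplane_volume.
congr lebesgue_tuple; apply/predeqP => y /=; rewrite /slice /= col_tupleK mulmxA -ZQ.
by split=> [[]//|h]; split => //; exact: dotp_frame.
Qed.

(** Adding the frame to the variables gives no new volumes, and every admissible pair $(\theta,t)$
    extends by [hyperplane_frame]. *)
Lemma P_starE : P_star r g = ereal_sup [set lebesgue_tuple (slice u) | u in Omega_Z r].
Proof.
congr ereal_sup; apply/seteqP; split => V /=.
  move=> [theta [t [h1 h2 ->]]].
  have hO := hyperplane_frameP h1.
  have [e1 e2 e3] := omega_pointE theta t (hyperplane_frame theta).
  have uO : Omega_Z r (omega_point theta t (hyperplane_frame theta)).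
    by split; rewrite ?e1 ?e2 ?e3.
  by exists (omega_point theta t (hyperplane_frame theta)) => //;
     rewrite -hyperplane_volumeE// e1 e2.
move=> [u uO <-]; exists (omega_theta u), (omega_t u); split.
- have [_ /orthogonal_frameP[h1 _ _]] := uO.
  by apply/eqP; rewrite -(@eqrXn2 _ 2) ?norm2_ge0// norm2_dotp h1 expr1n.
- by have [] := uO.
- by rewrite hyperplane_volumeE.
Qed.

Lemma Omega_Z_nonempty : @Omega_Z R m r !=set0.
Proof.
pose e : 'cV[R]_m.+1 := delta_mx 0 0.
have n1 : norm2 e = 1.
  apply/eqP; rewrite -(@eqrXn2 _ 2) ?norm2_ge0// sqr_norm2 (bigD1 0)//= mxE eqxx.
  by rewrite big1 ?addr0// => i i0; rewrite mxE (negbTE i0) expr0n.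
have [e1 e2 e3] := omega_pointE e 0 (hyperplane_frame e).
exists (omega_point e 0 (hyperplane_frame e)).
by split; rewrite ?e1 ?e2 ?e3; [rewrite oppr_le0 ltW|exact: hyperplane_frameP].
Qed.

End sections.

(** * Polynomial approximation of indicators *)

Section approximation.
Context {R : realType}.

(** The classical iteration for $\sqrt{z^2}$, with a rate $2/n$ that is uniform in $z$; it gives
    uniform polynomial approximation of the absolute value. *)
Lemma sqrt_iteration (z : R) (a : nat -> R) : 0 <= z <= 1 -> a 0%N = 0 ->
  (forall n, a n.+1 = a n + (z ^+ 2 - a n ^+ 2) / 2) ->
  forall n, 0 <= a n <= z /\ (z - a n) * n%:R <= 2.
Proof.
move=> /andP[z0 z1] a0 aS n.
suff [/andP[an0 anz] h] : 0 <= a n <= z /\ (z - a n) * (2 + n%:R * z) <= 2 * z.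
  rewrite an0 anz; split => //; have [z_gt0|zle0] := ltP 0 z.
    rewrite -(ler_pM2r z_gt0); apply: le_trans h.
    by rewrite -mulrA ler_wpM2l ?subr_ge0// lerDr.
  have -> : z - a n = 0 by apply/eqP; rewrite eq_le subr_ge0 anz andbT; lra.
  by rewrite mul0r.
elim: n => [|n [/andP[an0 anz] h]].
  by rewrite a0 lexx z0 subr0 mul0r addr0 mulrC.
have E : z - a n.+1 = (z - a n) * (1 - (z + a n) / 2) by rewrite aS; field.
have d0 : 0 <= z - a n by rewrite subr_ge0.
have k0 : 0 <= 1 - (z + a n) / 2 by lra.
have nz : 0 <= n%:R * z by rewrite mulr_ge0.
split.
  rewrite -[a n.+1 <= z]subr_ge0 E mulr_ge0// andbT aS.
  by rewrite addr_ge0// divr_ge0// subr_ge0 ler_sqr.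
apply: le_trans h; rewrite E -mulrA ler_wpM2l//.
(* Since $a_n\ge0$, the contraction factor is at most $1-z/2$. *)
apply: (@le_trans _ _ ((1 - z / 2) * (2 + n.+1%:R * z))).
  by rewrite ler_wpM2r//; [rewrite addr_ge0// mulr_ge0|lra].
rewrite -natr1 -subr_ge0 (_ : _ - _ = (n%:R * z * z + z * z) / 2); last by field.
by rewrite divr_ge0// addr_ge0// mulr_ge0.
Qed.

Variables (N : nat) (K : set 'cV[R]_N) (c : R).
Hypothesis Kc : forall x, K x -> forall i, `|x i 0| <= c.
Implicit Types (f : 'cV[R]_N -> R) (p : {mpoly R[N]}).

Definition approximable f := forall e, 0 < e ->
  exists p, forall x, K x -> `|peval p x - f x| <= e.

Lemma approximable_peval p : approximable (peval p).
Proof. by move=> e e0; exists p => x _; rewrite subrr normr0 ltW. Qed.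

Lemma approximableD f g : approximable f -> approximable g ->
  approximable (fun x => f x + g x).
Proof.
move=> hf hg e e0; have e2 : 0 < e / 2 by rewrite divr_gt0.
have [p hp] := hf _ e2; have [q hq] := hg _ e2; exists (p + q) => x Kx.
rewrite pevalD opprD addrACA (le_trans (ler_normD _ _))// [leRHS]splitr.
by apply: lerD; [exact: hp|exact: hq].
Qed.

Lemma approximableZ k f : approximable f -> approximable (fun x => k * f x).
Proof.
move=> hf e e0; have k1 : 0 < `|k| + 1 by rewrite ltr_wpDl.
have [p hp] := hf _ (divr_gt0 e0 k1); exists (k *: p) => x Kx.
rewrite pevalZ -mulrBr normrM (@le_trans _ _ ((`|k| + 1) * (e / (`|k| + 1))))//.
  by apply: ler_pM => //; [rewrite lerDl|exact: hp].
by rewrite mulrC divfK// gt_eqF.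
Qed.

Lemma approximable_ext f g : (forall x, K x -> f x = g x) -> approximable f ->
  approximable g.
Proof.
by move=> fg hf e /hf[p hp]; exists p => x Kx; rewrite -fg//; exact: hp.
Qed.

(** An approximant $p$ of $f$ is scaled to $q=p/b$ with $|q|\le1$ on $K$. The iteration at $z=|q|$
    involves only $z^2=q^2$, so its terms are polynomials. *)
Lemma approximable_norm f : approximable f -> approximable (fun x => `|f x|).
Proof.
move=> hf e e0; have e2 : 0 < e / 2 by rewrite divr_gt0.
have [p hp] := hf _ e2; have [b0 hb0] := peval_bounded p c.
pose b := `|b0| + 1; have b_gt0 : 0 < b by rewrite ltr_wpDl.
have hb x : K x -> `|peval p x| <= b.
  move=> Kx; rewrite (le_trans (hb0 _ (Kc Kx)))// (le_trans (ler_norm _))//.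
  by rewrite lerDl.
have bV : 0 <= b^-1 by rewrite invr_ge0 ltW.
pose q := b^-1 *: p.
pose A := fix A n : {mpoly R[N]} :=
  if n is n'.+1 then A n' + 2^-1 *: (q ^+ 2 - A n' ^+ 2) else 0.
(* The iteration error, scaled back by $b$, is at most $2b/n$, and this is below $e/2$. *)
have [n nb] : exists n : nat, 4 * b / e < n%:R.
  by exists (Num.trunc (4 * b / e)).+1; rewrite truncnS_gt.
exists (b *: A n) => x Kx.
have q1 : 0 <= `|peval q x| <= 1.
  rewrite normr_ge0 pevalZ normrM (ger0_norm bV).
  by rewrite mulrC ler_pdivrMr// mul1r hb.
have AS k : peval (A k.+1) x = peval (A k) x + (`|peval q x| ^+ 2 - peval (A k) x ^+ 2) / 2.
  by rewrite /= pevalD pevalZ pevalB !pevalXn real_normK ?num_real// mulrC.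
have [/andP[A0 Aq] dA] := sqrt_iteration q1 (peval0 x) AS n.
have n0 : 0 < n%:R :> R by apply: le_lt_trans nb; rewrite divr_ge0 ?mulr_ge0// ltW.
rewrite pevalZ (splitr e) -[b * _ - _](subrKA `|peval p x|).
rewrite (le_trans (ler_normD _ _))//; apply: lerD; last first.
  exact: le_trans (ler_dist_dist _ _) (hp _ Kx).
have -> : `|peval p x| = b * `|peval q x|.
  rewrite pevalZ normrM (ger0_norm bV) mulrA divff ?mul1r//.
  by rewrite gt_eqF.
rewrite -mulrBr normrM (gtr0_norm b_gt0) distrC ger0_norm ?subr_ge0//.
rewrite -(ler_pM2r n0) -mulrA (@le_trans _ _ (b * 2))//.
  by rewrite ler_wpM2l// ltW.
by move: nb; rewrite ltr_pdivrMr//; lra.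
Qed.

Lemma approximable_min0 f : approximable f -> approximable (fun x => Num.min 0 (f x)).
Proof.
move=> hf; apply: (@approximable_ext (fun x => 2^-1 * (f x + -1 * `|f x|))).
  move=> x _; have [f0|f0] := leP 0 (f x).
    by rewrite ger0_norm// mulN1r subrr mulr0.
  by rewrite ltr0_norm//; lra.
apply: approximableZ; apply: approximableD => //.
exact/approximableZ/approximable_norm.
Qed.

Lemma approximable_max0 f : approximable f -> approximable (fun x => Num.max 0 (f x)).
Proof.
move=> hf; apply: (@approximable_ext (fun x => 2^-1 * (f x + `|f x|))).
  move=> x _; have [f0|f0] := leP 0 (f x).
    by rewrite ger0_norm//; lra.
  by rewrite ltr0_norm//; lra.
by apply: approximableZ; apply: approximableD => //; exact: approximable_norm.
Qed.

Lemma approximable_sum I (s : seq I) (F : I -> 'cV[R]_N -> R) :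
  (forall i, approximable (F i)) -> approximable (fun x => \sum_(i <- s) F i x).
Proof.
move=> hF; elim: s => [|i s ih].
  apply: approximable_ext (approximable_peval 0) => x _.
  by rewrite big_nil peval0.
apply: (@approximable_ext (fun x => F i x + \sum_(j <- s) F j x)).
  by move=> x _; rewrite big_cons.
exact: approximableD.
Qed.

Lemma indicator_approximation (h : seq {mpoly R[N]}) :
  exists w : nat -> {mpoly R[N]}, forall x, K x ->
    [/\ forall k, 0 < peval (w k) x,
        basic_semialgebraic h x -> forall k, 1 < peval (w k) x,
        forall k, peval (w k.+1) x <= peval (w k) x
      & peval (w k) x @[k --> \oo] --> (\1_(basic_semialgebraic h) x : R)].
Proof.
pose neg x := \sum_(p <- h) Num.min 0 (peval p x).
have neg_le0 x : neg x <= 0.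
  by apply: sumr_le0 => p _; rewrite ge_min lexx.
have negh x : basic_semialgebraic h x -> neg x = 0.
  move=> hx; rewrite /neg big_seq big1// => p ph.
  by apply/min_idPl; exact: hx.
have negN x : ~ basic_semialgebraic h x -> neg x < 0.
  move=> nh; rewrite lt_neqAle neg_le0 andbT; apply/eqP => n0; apply: nh => p ph.
  rewrite leNgt; apply/negP => px; have : neg x < 0; last by rewrite n0 ltxx.
  rewrite /neg (big_rem p)//=; apply: (@le_lt_trans _ _ (Num.min 0 (peval p x))).
    by rewrite gerDl; apply: sumr_le0 => q _; rewrite ge_min lexx.
  by rewrite gt_min px orbT.
pose f (k : nat) x := Num.max 0 (1 + k%:R * neg x).
have fk k : approximable (f k).
  apply: approximable_max0; apply: approximableD.
    apply: approximable_ext (approximable_peval 1) => x _; exact: peval1.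
  apply: approximableZ; apply: approximable_sum => p.
  exact/approximable_min0/approximable_peval.
pose eta (k : nat) : R := 2^-1 ^+ k.
have eta0 k : 0 < eta k by rewrite exprn_gt0.
have etaS k : 2 * eta k.+1 = eta k by rewrite /eta exprS mulrA divff ?mul1r.
have hw k : exists p, forall x, K x -> f k x + eta k <= peval p x <= f k x + 2 * eta k.
  have [p hp] := fk k _ (divr_gt0 (eta0 k) (ltr0n _ 2)).
  (* The approximation error is $\eta_k/2$; a shift by $3\eta_k/2$ moves the values between
     $f_k+\eta_k$ and $f_k+2\eta_k$. *)
  exists (p + (3 / 2 * eta k)%:A) => x /hp; rewrite pevalD pevalA ler_norml.
  by move=> /andP[h1 h2]; apply/andP; split; lra.
have [w ww] := choice hw; exists w => x Kx.
have wl k : f k x + eta k <= peval (w k) x by have /andP[] := ww k x Kx.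
have wr k : peval (w k) x <= f k x + 2 * eta k by have /andP[] := ww k x Kx.
have f0 k : 0 <= f k x by rewrite le_max lexx.
have f1 k : basic_semialgebraic h x -> f k x = 1.
  by move=> hx; rewrite /f negh// mulr0 addr0; apply/max_idPr.
split.
- by move=> k; apply: lt_le_trans (wl k); rewrite ltr_wpDl.
- by move=> hx k; apply: lt_le_trans (wl k); rewrite f1// ltrDl.
(* Because $\eta$ halves, $w_{k+1}\le f_{k+1}+2\eta_{k+1}=f_{k+1}+\eta_k\le f_k+\eta_k\le w_k$. *)
- move=> k; apply: le_trans (wr _) _; apply: le_trans (wl k); rewrite etaS lerD2r.
  rewrite /f ge_max le_max lexx /= le_max; apply/orP; right.
  by rewrite lerD2l -natr1 mulrDl mul1r gerDl.
have fI : \forall k \near \oo, f k x = \1_(basic_semialgebraic h) x.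
  have [hx|hx] := pselect (basic_semialgebraic h x).
    by apply: nearW => k; rewrite f1// indicE mem_set.
  exists (Num.trunc (- (neg x)^-1)).+1 => // k /= kN.
  rewrite indicE memNset// /f; apply/max_idPl.
  have nx := negN _ hx.
  have : - (neg x)^-1 < k%:R.
    by apply: lt_le_trans (truncnS_gt _) _; rewrite ler_nat.
  by rewrite -(ltr_nM2r nx) mulNr mulVf ?lt_eqF//; lra.
have cv (a : R) : \1_(basic_semialgebraic h) x + a * eta k @[k --> \oo] -->
    (\1_(basic_semialgebraic h) x : R).
  rewrite -[X in _ --> X]addr0 -[X in _ --> _ + X](mulr0 a).
  apply: cvgD; first exact: cvg_cst.
  apply: cvgMr; apply: cvg_expr; rewrite ger0_norm ?invr_ge0//; lra.
apply: (squeeze_cvgr _ (cv 1) (cv 2)).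
by apply: filterS fI => k <-; rewrite mul1r wl wr.
Qed.

End approximation.

(** * The hierarchy *)

Section archimedean_constraints.
Context {R : realType}.

Lemma qmodule_sum (A : comAlgType R) (Q : set A) (I : Type) (s : seq I) (P : pred I)
    (F : I -> A) : quadratic_module Q -> (forall i, P i -> Q (F i)) ->
  Q (\sum_(i <- s | P i) F i).
Proof.
by move=> qmQ h; elim/big_ind : _ => //; [exact: qmodule0|exact: qmoduleD].
Qed.

(** $c-X_i^2$ is $c-\|X\|^2$ plus the squares of the other variables. *)
Lemma ball_archimedean N (Q : set {mpoly R[N]}) (c : R) : quadratic_module Q ->
  Q (c%:A - \sum_i vars N i 0 ^+ 2) -> archimedean Q.
Proof.
move=> qmQ h; apply: mpoly_archimedean => // i; exists c.
rewrite (_ : _ - _ = (c%:A - \sum_i vars N i 0 ^+ 2) +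
    \sum_(j | j != i) vars N j 0 ^+ 2).
  by apply: qmoduleD => //; apply: qmodule_sum => // j _; exact: qmoduleX.
by rewrite (bigD1 i)//= opprD -addrA -addrA addNr addr0 mxE.
Qed.

(** The trace of $Q^TQ$ is the sum of the squares of all entries of $Q$. *)
Lemma sum_sqr_omega (A : comNzRingType) m (u : 'cV[A]_(omega_dim m)) :
  \sum_i u i 0 ^+ 2 = omega_t u ^+ 2 +
    \sum_j ((frame_mx (omega_theta u) (omega_Z u))^T *m
            frame_mx (omega_theta u) (omega_Z u)) j j.
Proof.
rewrite (@big_split_ord _ _ _ (m.+1 + 1) (m.+1 * m)) big_split_ord /= big_ord1.
rewrite addrAC [LHS]addrC /omega_t !mxE; congr (_ + _).
rewrite [RHS](@big_split_ord _ _ _ 1 m) /= big_ord1; congr (_ + _).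
  rewrite mxE; apply: eq_bigr => i _; rewrite mxE.
  by rewrite /frame_mx (@row_mxEl _ _ 1 m) !mxE expr2; congr (u _ _ * u _ _); exact: val_inj.
under [RHS]eq_bigr => j _.
  rewrite mxE; under eq_bigr => i _.
    rewrite mxE /frame_mx (@row_mxEr _ _ 1 m) !mxE -expr2.
    over.
  over.
rewrite exchange_big pair_bigA /=.
rewrite (reindex _ (curry_mxvec_bij _ _)) /=.
by apply: eq_bigr => -[i j] _ /=.
Qed.

(** The trace of $I$ is $m+1$, so the polynomial is $r^2-t^2$ plus the negated diagonal entries of
    $Q^TQ-I$, all of them constraints. *)
Lemma qmodule_omega_ball N m (r : R) (Q : set {mpoly R[N]})
    (u : 'cV[{mpoly R[N]}]_(omega_dim m)) : quadratic_module Q ->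
  (forall p, p \in omega_constraints (mpolyC N r) u -> Q p) ->
  Q ((r ^+ 2 + m.+1%:R)%:A - \sum_i u i 0 ^+ 2).
Proof.
move=> qmQ h; rewrite sum_sqr_omega.
set G := _^T *m _; pose E := G - 1%:M.
rewrite (_ : _ - _ = (mpolyC N r ^+ 2 - omega_t u ^+ 2) + \sum_j - E j j).
  apply: qmoduleD => //; first by apply: h; rewrite mem_head.
  apply: qmodule_sum => // j _; apply: h; rewrite inE mem_cat; apply/orP; right.
  by apply/orP; right; apply: map_f; apply/allpairsP; exists (j, j); rewrite !mem_enum.
rewrite scalerDl opprD addrACA; congr (_ + _).
  by rewrite alg_mpolyC rmorphXn.
rewrite [RHS](eq_bigr (fun j => 1 - G j j)) => [|j _].
  by rewrite sumrB sumr_const card_ord scaler_nat.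
rewrite /E mxE [X in - (_ + X)]mxE [X in - (_ - X)]mxE eqxx.
by rewrite opprB.
Qed.

Lemma archimedean_omega m (r : R) : archimedean (qmodule_of (@omega_polys R m r)).
Proof.
apply: (@ball_archimedean _ _ (r ^+ 2 + m.+1%:R)); first exact: quadratic_module_of.
apply: qmodule_omega_ball; first exact: quadratic_module_of.
by move=> p; exact: qmodule_of_mem.
Qed.

Lemma ball_psi m (r : R) (Q : set {mpoly R[psi_dim m]}) : quadratic_module Q ->
  (forall p, p \in @psi_polys R m r -> Q p) ->
  Q ((r ^+ 2 + m.+1%:R + r ^+ 2)%:A - \sum_i vars (psi_dim m) i 0 ^+ 2).
Proof.
move=> qmQ h; rewrite (@big_split_ord _ _ _ (omega_dim m) m) /=.
rewrite (_ : \sum_(i < omega_dim m) _ = \sum_i psi_omega (vars (psi_dim m)) i 0 ^+ 2); last first.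
  by apply: eq_bigr => i _; rewrite /psi_omega [in RHS]mxE.
rewrite (_ : \sum_(i < m) _ = \sum_i psi_y (vars (psi_dim m)) i 0 ^+ 2); last first.
  by apply: eq_bigr => i _; rewrite /psi_y [in RHS]mxE.
rewrite opprD scalerDl addrACA; apply: qmoduleD => //.
  apply: qmodule_omega_ball => // p hp; apply: h.
  by rewrite /psi_polys /psi_constraints mem_rcons inE hp orbT.
rewrite alg_mpolyC rmorphXn /=; apply: h.
by rewrite /psi_polys /psi_constraints mem_rcons mem_head.
Qed.

Lemma archimedean_psi m (r : R) (h : seq {mpoly R[psi_dim m]}) :
  {subset @psi_polys R m r <= h} -> archimedean (qmodule_of h).
Proof.
move=> sub; have qm := quadratic_module_of h.
apply: (@ball_archimedean _ _ (r ^+ 2 + m.+1%:R + r ^+ 2) qm).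
by apply: ball_psi qm _ => p /sub; exact: qmodule_of_mem.
Qed.

Lemma archimedean_bounded N (h : seq {mpoly R[N]}) : archimedean (qmodule_of h) ->
  exists c : R, forall x, basic_semialgebraic h x -> forall i, `|x i 0| <= c.
Proof.
move=> arh; have [c [d hd]] := arh (\sum_i vars N i 0 ^+ 2).
(* $|x_i|^2\le c\le(|c|+1)^2$, which avoids a square root. *)
exists (`|c| + 1) => x hx i; have := trunc_qmodule_ge0 hd hx.
rewrite pevalB pevalA subr_ge0 peval_sum => le_c.
have xc : `|x i 0| ^+ 2 <= c.
  apply: le_trans le_c; rewrite (bigD1 i)//= pevalXn mxE pevalX real_normK ?num_real//.
  by rewrite lerDl; apply: sumr_ge0 => j _; rewrite pevalXn sqr_ge0.
rewrite -ler_sqr ?nnegrE ?addr_ge0// (le_trans xc)// (le_trans (ler_norm c))//.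
by have := normr_ge0 c; nra.
Qed.

End archimedean_constraints.

(** * Validity of the bounds, and convergence *)

Section convergence.
Context {R : realType}.
Variables (m : nat) (r : R) (g : seq {mpoly R[m.+1]}).
Hypotheses (r_gt0 : 0 < r) (ball_g : ball_poly m.+1 r \in g).
Implicit Types (u : 'cV[R]_(omega_dim m)) (v : 'cV[R]_(psi_dim m))
  (w : {mpoly R[psi_dim m]}).

Lemma Psi_col_mx u (y : m.-tuple R) :
  Psi r (col_mx u (tuple_col y) : 'cV[R]_(psi_dim m)) <->
  Omega_Z r u /\ tuple_ball r y.
Proof. by rewrite /Psi /= /psi_omega /psi_y col_mxKu col_mxKd. Qed.

(** On the ball, $w$ dominates the indicator of the slice: the certificate over [Psi_L] gives
    $w\ge1$ on the slice, the one over [Psi] gives $w\ge0$ elsewhere. *)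
Lemma feasible_le k gamma w u : feasible r g k gamma w -> Omega_Z r u ->
  (lebesgue_tuple (slice g u) <= gamma%:E)%E.
Proof.
move=> [_ [q hq qE] hL hP] uO.
have r0 := ltW r_gt0.
apply: (@le_trans _ _ (Lambda r w u)%:E); last first.
  rewrite lee_fin -subr_ge0 -qE; apply: trunc_qmodule_ge0 hq _.
  by rewrite omega_polysE.
rewrite LambdaE// -(setIidl (slice_ball r_gt0 ball_g uO)).
rewrite -integral_indic//; [|exact: measurable_tuple_ball|exact: measurable_slice].
apply: ge0_le_integral => //.
- exact: measurable_tuple_ball.
- by apply/measurable_EFinP; apply: measurable_indic; exact: measurable_slice.
- apply/measurable_EFinP/measurable_funTS; apply: measurable_peval => i.
  exact: measurable_fiber.
move=> y yB; rewrite lee_fin indicE.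
have [|_] := boolP (y \in slice g u).
  rewrite inE => ys.
  have := @trunc_qmodule_ge0 _ _ _ _ _ (col_mx u (tuple_col y)) hL.
  rewrite pevalB peval1 subr_ge0; apply; rewrite psiL_polysE//; split.
    exact/Psi_col_mx.
  by rewrite psi_x_col_mx.
apply: trunc_qmodule_ge0 hP _.
by rewrite psi_polysE//; apply/Psi_col_mx.
Qed.

Lemma P_star_le k : (P_star r g <= p_star r g k)%E.
Proof.
apply: le_ereal_inf_tmp => _ [gamma [w hw] <-].
rewrite P_starE; apply: ge_ereal_sup => _ [u uO <-].
exact: feasible_le hw uO.
Qed.

Lemma p_star_nonincreasing k l : (k <= l)%N -> (p_star r g l <= p_star r g k)%E.
Proof.
move=> kl; have kl2 : (2 * k <= 2 * l)%N by rewrite leq_mul2l.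
apply: ereal_inf_le_tmp => _ [gamma [w [h1 [q hq qE] h2 h3]] <-].
exists gamma => //; exists w; split.
- by apply: leq_trans h1 _; rewrite ltnS.
- by exists q => //; exact: trunc_qmodule_le hq.
- exact: trunc_qmodule_le h2.
- exact: trunc_qmodule_le h3.
Qed.

(** Dominated convergence on the fibre over [u], the positive decreasing sequence being dominated by
    [w 0]. *)
Lemma Lambda_cvg u (w : nat -> {mpoly R[psi_dim m]}) : Omega_Z r u ->
  (forall v, Psi r v -> [/\ forall k, 0 < peval (w k) v,
     forall k, peval (w k.+1) v <= peval (w k) v
   & peval (w k) v @[k --> \oo] --> (\1_(Psi_L r g) v : R)]) ->
  (Lambda r (w k) u)%:E @[k --> \oo] --> lebesgue_tuple (slice g u).
Proof.
move=> uO hw; have r0 := ltW r_gt0.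
have inPsi y : tuple_ball r y -> Psi r (col_mx u (tuple_col y)).
  by move=> yB; exact/Psi_col_mx.
pose F k y := (peval (w k) (col_mx u (tuple_col y)))%:E.
have mF k : measurable_fun (tuple_ball r) (F k).
  apply/measurable_EFinP/measurable_funTS; apply: measurable_peval => i.
  exact: measurable_fiber.
have mI : measurable_fun (tuple_ball r) (fun y => (\1_(slice g u) y)%:E : \bar R).
  by apply/measurable_EFinP; apply: measurable_indic; exact: measurable_slice.
have cF : {ae @lebesgue_tuple R m, forall y, tuple_ball r y ->
    F k y @[k --> \oo] --> (\1_(slice g u) y)%:E}.
  apply: aeW => y yB; have [_ _ cv] := hw _ (inPsi _ yB).
  apply/fine_cvgP; split; first exact: nearW.
  rewrite (_ : \1_(slice g u) y = \1_(Psi_L r g) (col_mx u (tuple_col y))) //.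
  rewrite !indicE; congr (_%:R); congr nat_of_bool.
  apply/idP/idP; rewrite !inE.
    by move=> ys; split; [exact: inPsi|rewrite psi_x_col_mx].
  by move=> [_]; rewrite psi_x_col_mx.
have dF : {ae @lebesgue_tuple R m, forall y, forall k, tuple_ball r y ->
    (`|F k y| <= F 0%N y)%E}.
  apply: aeW => y k yB; have [pos dec _] := hw _ (inPsi _ yB).
  rewrite gee0_abs ?lee_fin; last exact: ltW.
  elim: k => [//|k ih]; exact: le_trans (dec k) ih.
have [_ _ +] := dominated_convergence (@measurable_tuple_ball R m r) mF mI cF
  (integrable_fiber r0 (w 0%N) u) dF.
rewrite (integral_indic _ (@measurable_tuple_ball R m r) (@measurable_slice R m g u)).
rewrite setIidl; last exact: slice_ball.
by under eq_fun do rewrite -LambdaE//.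
Qed.

(** Dini's argument by contradiction: points $u_k$ with $\Lambda_Rw_k(u_k)\ge c$ cluster at some
    $x\in\Omega_Z$. Then $\Lambda_Rw_k(x)\ge c$ for every $k$, and in the limit the slice at $x$ has
    volume at least $c>P^*$. *)
Lemma uniform_Lambda_lt (c : R) : (P_star r g < c%:E)%E ->
  exists w, [/\ forall u, Omega_Z r u -> Lambda r w u < c,
    forall v, Psi r v -> 0 < peval w v
  & forall v, Psi_L r g v -> 1 < peval w v].
Proof.
move=> Pc; have r0 := ltW r_gt0.
have [b hb] : exists b : R, forall v, Psi r v -> forall i, `|v i 0| <= b.
  have [|b hb] := @archimedean_bounded R _ (psi_polys m r).
    exact: (@archimedean_psi R m r _ (fun=> id)).
  by exists b => v hv; apply: hb; rewrite psi_polysE.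
have [w hw] := indicator_approximation hb (psiL_polys r g).
rewrite psiL_polysE// in hw.
suff [k hk] : exists k, forall u, Omega_Z r u -> Lambda r (w k) u < c.
  exists (w k); split => // v hv; first by have [] := hw v hv.
  by have [_ + _ _] := hw v hv.1; exact.
apply: contrapT => nk.
have hu k : exists u, Omega_Z r u /\ c <= Lambda r (w k) u.
  apply: contrapT => nu; apply: nk; exists k => u uO.
  by rewrite ltNge; apply/negP => cu; apply: nu; exists u.
have [u uP] := choice hu.
have [b' hb'] := archimedean_bounded (@archimedean_omega R m r).
rewrite omega_polysE// in hb'.
have [x xP] := bounded_cluster (fun k => hb' (u k) (uP k).1).
have xO : Omega_Z r x.
  rewrite -omega_polysE// => p ph; apply: xP; apply: nearW => k.
  by have := (uP k).1; rewrite -omega_polysE//; exact.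
have xc k : c <= Lambda r (w k) x.
  (* For fixed $k$, $\Lambda_Rw_k$ is a polynomial in $u$, and for $l\ge k$ its value at $u_l$ is at
     least $\Lambda_Rw_l(u_l)\ge c$. The inequality holds eventually along the sequence, so it
     passes to $x$. *)
  have [q qE] := Lambda_mpoly r0 (w k).
  have := xP (q - c%:A); rewrite pevalB pevalA qE subr_ge0; apply.
  exists k => // l /= kl; rewrite pevalB pevalA qE subr_ge0.
  apply: le_trans (uP l).2 _; apply: Lambda_le => // y yB.
  have /hw[_ _ dec _] : Psi r (col_mx (u l) (tuple_col y)).
    by apply/Psi_col_mx; split => //; exact: (uP l).1.
  move: dec; set v := col_mx _ _ => dec.
  rewrite -(subnK kl); elim: (l - k)%N => [//|i ih].
  by rewrite addSn; exact: le_trans (dec _) ih.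
have cv : (Lambda r (w k) x)%:E @[k --> \oo] --> lebesgue_tuple (slice g x).
  by apply: Lambda_cvg => // v /hw[].
have : (c%:E <= lebesgue_tuple (slice g x))%E.
  rewrite -(cvg_lim (@ereal_hausdorff R) cv); apply: lime_ge.
    by apply/cvg_ex; eexists; exact: cv.
  by apply: nearW => k; rewrite lee_fin.
apply/negP; rewrite -ltNge; apply: le_lt_trans Pc.
by rewrite P_starE; apply: ereal_sup_ubound; exists x.
Qed.

(** All three inequalities for [w] are strict, so Putinar's theorem certifies each of them in some
    finite degree. *)
Lemma p_star_le (c : R) : (P_star r g < c%:E)%E ->
  exists k, (p_star r g k <= c%:E)%E.
Proof.
move=> /uniform_Lambda_lt[w [h1 h2 h3]]; have r0 := ltW r_gt0.
have [q qE] := Lambda_mpoly r0 w.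
have [d1 hd1] : qmodule_of (omega_polys m r) (c%:A - q).
  apply: putinar => [|u]; first exact: archimedean_omega.
  by rewrite omega_polysE// => uO; rewrite pevalB pevalA qE subr_gt0 h1.
have [d2 hd2] : qmodule_of (psiL_polys r g) (w - 1).
  apply: putinar => [|v].
    by apply: (@archimedean_psi R m r) => p hp; rewrite mem_cat hp.
  by rewrite psiL_polysE// => vL; rewrite pevalB peval1 subr_gt0 h3.
have [d3 hd3] : qmodule_of (psi_polys m r) w.
  apply: putinar => [|v]; first exact: (@archimedean_psi R m r _ (fun=> id)).
  by rewrite psi_polysE//; exact: h2.
(* The sum dominates the three certificate degrees and the degree of [w] at once. *)
pose k := (d1 + d2 + d3 + mpoly.msize w)%N.
have le2 d : (d <= k)%N -> (d <= 2 * k)%N.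
  by move=> dk; rewrite (leq_trans dk)// leq_pmull.
exists k; apply: ereal_inf_lbound; exists c => //; exists w; split.
- by rewrite /deg_le (leq_trans (le2 _ _))// leq_addl.
- exists (c%:A - q); last by move=> u; rewrite pevalB pevalA qE.
  by apply: trunc_qmodule_le hd1; apply: le2; rewrite /k -!addnA leq_addr.
- by apply: trunc_qmodule_le hd2; apply: le2; rewrite /k -!addnA addnCA leq_addr.
- by apply: trunc_qmodule_le hd3; apply: le2; rewrite /k addnAC leq_addl.
Qed.

End convergence.

Theorem theorem4p2 (R : realType) (m : nat) (r : R)
    (g : seq {mpoly R[m.+1]}) (r_gt0 : 0 < r)
    (ball_g : ball_poly m.+1 r \in g) :
  [/\ forall k : nat, (p_star r g k.+1 <= p_star r g k)%E,
      forall k : nat, (P_star r g <= p_star r g k)%E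
    & p_star r g @ \oo --> P_star r g].
Proof.
split=> [k|k|]; [exact: p_star_nonincreasing|exact: P_star_le|].
have dec : {homo p_star r g : k l / (k <= l)%N >-> (l <= k)%E}.
  by move=> k l; exact: p_star_nonincreasing.
have cv := ereal_nonincreasing_cvgn dec.
(* A nonincreasing sequence converges to its infimum, so only this infimum remains to be
   identified. *)
rewrite (_ : P_star r g = ereal_inf (range (p_star r g)))//.
apply/eqP; rewrite eq_le; apply/andP; split.
  by apply: le_ereal_inf_tmp => _ [k _ <-]; exact: P_star_le.
have P0 : (0 <= P_star r g)%E.
  have [u uO] := @Omega_Z_nonempty R m r r_gt0.
  rewrite P_starE; apply: (@le_trans _ _ (lebesgue_tuple (slice g u))).
    exact: measure_ge0.
  by apply: ereal_sup_ubound; exists u.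
(* Nonnegativity excludes $-\infty$, and for $P^*=+\infty$ the inequality is trivial; only a finite
   $P^*$ needs approximation from above. *)
case PE : (P_star r g) P0 => [p| |] // _; last by rewrite leey.
apply/lee_addgt0Pr => e e0.
have [k hk] : exists k, (p_star r g k <= (p + e)%:E)%E.
  by apply: p_star_le => //; rewrite PE lte_fin ltrDl.
by rewrite -EFinD; apply: le_trans hk; apply: ereal_inf_lbound; exists k.
Qed.
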